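(* There is an algorithm that solves \textsc{Dominator Coloring} in $O^*(4^n)$ time and exponential space, where $n$ is the number of vertices of the input graph.
   Context: All graphs are finite and simple; $N_G[v]=N_G(v)\cup\{v\}$. A coloring $\chi:V(G)\to C$ is proper if adjacent vertices get different colors; $|\chi|$ is the number of colors used. A vertex $v$ dominates a set $S$ if $S\subseteq N_G[v]$. A dominator coloring of $G$ is a proper coloring such that every vertex dominates some color class. \textsc{Dominator Coloring}: given $G$ and an integer $\ell$, decide whether $G$ has a dominator coloring with at most $\ell$ colors. $O^*(\cdot)$ hides polynomial factors. *)

(* Defs.v *)
From HB Require Import structures.
From mathcomp Require Import all_boot.
From mathcomp Require Import finmap.
Set Implicit Arguments.
Unset Strict Implicit.
Unset Printing Implicit Defensive.

Record sgraph (T : finType) := SGraph {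
  adj :> rel T;
  adj_sym : symmetric adj;
  adj_irr : irreflexive adj
}.

Section DominatorColoring.
Variables (T : finType) (G : sgraph T).

Definition closed_nbhd (v : T) : {set T} := [set u | adj G v u || (u == v)].

Definition dominates (v : T) (S : {set T}) : bool := S \subset closed_nbhd v.

Section Coloring.
Variables (C : finType) (chi : T -> C).

Definition proper_coloring : Prop := forall u v, adj G u v -> chi u != chi v.

Definition num_colors : nat := #|[set chi v | v : T]|.

(* Only colors that are used give a color class, so classes are nonempty. *)
Definition color_classes : {set {set T}} :=
  [set [set u | chi u == chi v] | v : T].

Definition dominator_coloring : Prop :=
  proper_coloring /\
  forall v, exists2 S, S \in color_classes & dominates v S.

End Coloring.

Definition has_dominator_coloring (l : nat) : Prop :=
  exists (C : finType) (chi : T -> C),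
    dominator_coloring chi /\ num_colors chi <= l.

End DominatorColoring.

(* Random access machine with the logarithmic cost criterion (Cook-Reckhow;
   Aho, Hopcroft and Ullman, The Design and Analysis of Computer Algorithms,
   Section 1.3), in three-address form.  Registers hold natural numbers; the
   input is a tape of natural numbers that is read from left to right.         *)

Inductive operand :=
  | Imm of nat    (* the constant k *)
  | Dir of nat    (* the content of register i *)
  | Ind of nat.   (* the content of the register whose index is in register i *)

Inductive target :=
  | ToDir of nat
  | ToInd of nat.

(* Subtraction is truncated; division is Euclidean, with x / 0 = 0. *)
Inductive arith := OpAdd | OpSub | OpMul | OpDiv.

Inductive instr :=
  | Arith of arith & target & operand & operand
  | Read of target
  | Jzero of operand & nat
  | Halt of bool.

Definition program := seq instr.

Definition memory := {fsfun nat -> nat with 0}.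

Record config := Config { pc : nat; tape : seq nat; mem : memory }.

(* Length of the binary representation, with bitlen 0 = 1. *)
Definition bitlen (x : nat) : nat := (trunc_log 2 x).+1.

Definition arith_val (o : arith) (x y : nat) : nat :=
  match o with
  | OpAdd => x + y
  | OpSub => x - y
  | OpMul => x * y
  | OpDiv => x %/ y
  end.

Definition operand_val (m : memory) (a : operand) : nat :=
  match a with
  | Imm k => k
  | Dir i => m i
  | Ind i => m (m i)
  end.

Definition operand_cost (m : memory) (a : operand) : nat :=
  match a with
  | Imm k => bitlen k
  | Dir i => bitlen i + bitlen (m i)
  | Ind i => bitlen i + bitlen (m i) + bitlen (m (m i))
  end.

Definition target_reg (m : memory) (d : target) : nat :=
  match d with
  | ToDir i => i
  | ToInd i => m i
  end.

Definition store (m : memory) (d : target) (x : nat) : memory :=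
  [fsfun m with target_reg m d |-> x].

Definition store_cost (m : memory) (d : target) (x : nat) : nat :=
  match d with
  | ToDir i => bitlen i + bitlen x
  | ToInd i => bitlen i + bitlen (m i) + bitlen x
  end.

(* Reading beyond the end of the tape yields 0. *)
Definition instr_step (i : instr) (c : config) : config :=
  let: Config p w m := c in
  match i with
  | Arith o d a b =>
      Config p.+1 w (store m d (arith_val o (operand_val m a) (operand_val m b)))
  | Read d => Config p.+1 (behead w) (store m d (head 0 w))
  | Jzero a q => Config (if operand_val m a == 0 then q else p.+1) w m
  | Halt _ => c
  end.

Definition instr_cost (i : instr) (c : config) : nat :=
  let: Config p w m := c in
  match i with
  | Arith o d a b =>
      operand_cost m a + operand_cost m b +
      store_cost m d (arith_val o (operand_val m a) (operand_val m b))
  | Read d => store_cost m d (head 0 w)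
  | Jzero a _ => operand_cost m a
  | Halt _ => 1
  end.

Definition is_halt (i : instr) : bool := if i is Halt _ then true else false.

(* Logarithmic space: indices and contents of the nonzero registers. *)
Definition mem_space (m : memory) : nat :=
  \sum_(i <- finsupp m) (bitlen i + bitlen (m i)).

(* run P c b t s: started in c, the program P halts with answer b, after time t
   and with peak memory usage s.  A program counter outside P is stuck: no run. *)
Inductive run (P : program) : config -> bool -> nat -> nat -> Prop :=
  | run_halt c b :
      onth P (pc c) = Some (Halt b) -> run P c b 1 (mem_space (mem c))
  | run_step c i b t s :
      onth P (pc c) = Some i -> ~~ is_halt i ->
      run P (instr_step i c) b t s ->
      run P c b (instr_cost i c + t) (maxn (mem_space (mem c)) s).

Record dc_instance := DCInstance {
  dc_order : nat;
  dc_graph : sgraph 'I_dc_order;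
  dc_budget : nat
}.

(* n, then l, then the adjacency matrix in row-major order. *)
Definition dc_input (x : dc_instance) : seq nat :=
  [:: dc_order x, dc_budget x &
      [seq nat_of_bool (dc_graph x i j) | i <- enum 'I_(dc_order x),
                                          j <- enum 'I_(dc_order x)]].

(* Number of bits of the input. *)
Definition dc_size (x : dc_instance) : nat :=
  bitlen (dc_order x) + bitlen (dc_budget x) + dc_order x ^ 2.

Definition initial_config (w : seq nat) : config := Config 0 w [fsfun].

Definition Ostar (f g : dc_instance -> nat) : Prop :=
  exists c k : nat, forall x, f x <= c * dc_size x ^ k * g x.

Definition solves_dominator_coloring (P : program)
    (time space : dc_instance -> nat) : Prop :=
  forall x : dc_instance, exists b : bool,
    run P (initial_config (dc_input x)) b (time x) (space x) /\
    (b <-> has_dominator_coloring (dc_graph x) (dc_budget x)).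

(* Main.v *)
Require Import Defs.
From mathcomp Require Import all_boot.
From mathcomp Require Import finmap zify.
From Stdlib Require Import ClassicalEpsilon FunctionalExtensionality.
Set Implicit Arguments.
Unset Strict Implicit.
Unset Printing Implicit Defensive.

(** A dominator coloring with at most [l] colors is the same as an exact cover of
    two disjoint copies of the vertex set by [min l n] pairs [(S, D)], where [S]
    is an independent set, every vertex of [D] dominates [S], and [S] is empty
    only if [D] is: [S] is a color class and [D] collects the vertices that
    choose it.  Give each such pair, a subset of a universe of [2n] elements, the
    weight [z ^ (|S| + |D|)].  Summing the weights over subsets, raising the sums
    to the power [min l n] and inverting the summation yields at the full set a
    polynomial in [z] that counts covers by total size.  All covers have size at
    least [2n], with equality for exact ones, so for [z] larger than the number
    of tuples the residue modulo [z ^ (2n + 1)] is nonzero iff an exact cover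
    exists.  Both transforms take [2n] passes over a table of [4 ^ n] numbers of
    polynomially many bits. *)

Lemma ltn_bitlen x : x < 2 ^ bitlen x.
Proof. exact: trunc_log_ltn. Qed.

Lemma bitlen_le x w : 0 < w -> x < 2 ^ w -> bitlen x <= w.
Proof.
case: x => [|x] w_gt0 lt_xw; first by rewrite /bitlen trunc_log0.
rewrite /bitlen -(ltn_exp2l _ _ (isT : 1 < 2)).
exact: leq_ltn_trans (trunc_logP _ _) lt_xw.
Qed.

Lemma leq_bitlen x y : x <= y -> bitlen x <= bitlen y.
Proof. by move=> le_xy; rewrite ltnS leq_trunc_log. Qed.

Lemma bitlen_arith o x y : bitlen (arith_val o x y) <= bitlen x + bitlen y.
Proof.
have le_l z : z <= x -> bitlen z <= bitlen x + bitlen y.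
  by move=> /leq_bitlen/leq_trans; apply; rewrite leq_addr.
have ltx := ltn_bitlen x; have lty := ltn_bitlen y.
case: o => /=; [| exact/le_l/leq_subr | | exact/le_l/leq_div];
  apply: bitlen_le; rewrite ?addn_gt0 // expnD; last by nia.
move: ltx lty; rewrite /bitlen !expnS.
have := expn_gt0 2 (trunc_log 2 x); have := expn_gt0 2 (trunc_log 2 y).
by move=> /=; nia.
Qed.

Lemma storeE m d x i : store m d x i = if i == target_reg m d then x else m i.
Proof. by rewrite /store fsfun_withE. Qed.

Lemma mem_space_store m d x :
  mem_space (store m d x) <= mem_space m + (bitlen (target_reg m d) + bitlen x).
Proof.
have split_sum (A : {fset nat}) k (F : nat -> nat) :
    \sum_(i <- A) F i = (k \in A) * F k + \sum_(i <- (A `\ k)%fset) F i.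
  have [kA | kA] := boolP (k \in A); first by rewrite mul1n (big_fsetD1 k).
  by rewrite mul0n mem_fsetD1.
rewrite /mem_space; set k := target_reg m d.
rewrite (split_sum (finsupp (store m d x)) k) (split_sum (finsupp m) k).
have ->: (finsupp (store m d x) `\ k = finsupp m `\ k)%fset.
  apply/fsetP=> i; rewrite !inE !mem_finsupp storeE -/k.
  by case: eqP.
rewrite [X in _ + X <= _](eq_big_seq (fun i => bitlen i + bitlen (m i))).
  rewrite storeE eqxx -/k; set S := bigop _ _ _; rewrite addnC -addnA addnCA leq_add2l.
  by case: (_ \in finsupp (store m d x)); rewrite ?mul1n ?mul0n // leq_addl.
by move=> i; rewrite !inE storeE -/k => /andP[/negPf->].
Qed.

Lemma run_space P c b t s : run P c b t s -> s <= mem_space (Defs.mem c) + t.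
Proof.
elim=> {c b t s} [c b _|c i b t s _ hi _ IH]; first by rewrite leq_addr.
rewrite geq_max leq_addr (leq_trans IH) // addnA leq_add2r.
have spc m d x :
    mem_space (store m d x) <= mem_space m + store_cost m d x.
  by apply: leq_trans (mem_space_store _ _ _) _; case: d => * /=; lia.
case: c {IH} => p w m; case: i hi => [o d x y|d|x q|] //= _; rewrite ?leq_addr //.
by apply: leq_trans (spc _ _ _) _; lia.
Qed.

(** * A structured language compiled to the machine *)

Inductive expr :=
  | Lit of nat
  | Var of nat
  | Get of expr
  | Bin of arith & expr & expr.

(* [For v e c] runs [c] with [v = j] for [j] from [e - 1] down to [0]. *)
Inductive cmd :=
  | Assign of nat & expr
  | Put of expr & expr
  | ReadTo of nat
  | Seq of cmd & cmd
  | For of nat & expr & cmd.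

Record state := State { inp : seq nat; vars : seq nat; arr : nat -> nat }.

Fixpoint eval (e : expr) (s : state) : nat :=
  match e with
  | Lit k => k
  | Var i => nth 0 (vars s) i
  | Get a => arr s (eval a s)
  | Bin o a b => arith_val o (eval a s) (eval b s)
  end.

Definition set_var (s : state) v x : state :=
  State (inp s) (set_nth 0 (vars s) v x) (arr s).

Definition set_arr (s : state) a x : state :=
  State (inp s) (vars s) (fun p => if p == a then x else arr s p).

Definition read_var (s : state) v : state :=
  State (behead (inp s)) (set_nth 0 (vars s) v (head 0 (inp s))) (arr s).

(* Registers: variables below [nvars], then temporaries, then the array from
   [base] on. *)
Definition nvars := 16.
Definition base := 32.

Fixpoint comp_expr (e : expr) (t : nat) : seq instr :=
  match e with
  | Lit k => [:: Arith OpAdd (ToDir t) (Imm k) (Imm 0)]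
  | Var i => [:: Arith OpAdd (ToDir t) (Dir i) (Imm 0)]
  | Get a => comp_expr a t ++
      [:: Arith OpAdd (ToDir t) (Dir t) (Imm base);
          Arith OpAdd (ToDir t) (Ind t) (Imm 0)]
  | Bin o a b => comp_expr a t ++ comp_expr b t.+1 ++
      [:: Arith o (ToDir t) (Dir t) (Dir t.+1)]
  end.

Fixpoint wf_expr (e : expr) (t : nat) : bool :=
  match e with
  | Lit _ => t < base
  | Var i => (i < nvars) && (t < base)
  | Get a => wf_expr a t
  | Bin _ a b => wf_expr a t && wf_expr b t.+1
  end.

Fixpoint compile (c : cmd) (p : nat) : seq instr :=
  match c with
  | Assign v e =>
      comp_expr e nvars ++ [:: Arith OpAdd (ToDir v) (Dir nvars) (Imm 0)]
  | Put a e =>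
      comp_expr a nvars ++ comp_expr e nvars.+1 ++
      [:: Arith OpAdd (ToDir nvars) (Dir nvars) (Imm base);
          Arith OpAdd (ToInd nvars) (Dir nvars.+1) (Imm 0)]
  | ReadTo v => [:: Read (ToDir v)]
  | Seq c1 c2 => compile c1 p ++ compile c2 (p + size (compile c1 p))
  | For v e c =>
      let init :=
        comp_expr e nvars ++ [:: Arith OpAdd (ToDir v) (Dir nvars) (Imm 0)] in
      let p1 := p + size init in
      let body := compile c p1.+2 in
      init ++
      [:: Jzero (Dir v) (p1 + (size body).+3);
          Arith OpSub (ToDir v) (Dir v) (Imm 1)] ++
      body ++ [:: Jzero (Imm 0) p1]
  end.

Fixpoint wf_cmd (c : cmd) : bool :=
  match c with
  | Assign v e => (v < nvars) && wf_expr e nvars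
  | Put a e => wf_expr a nvars && wf_expr e nvars.+1
  | ReadTo v => v < nvars
  | Seq c1 c2 => wf_cmd c1 && wf_cmd c2
  | For v e c => [&& v < nvars, wf_expr e nvars & wf_cmd c]
  end.

Definition bounded W (s : state) : Prop :=
  [/\ 0 < W, all (fun x => bitlen x <= W) (vars s)
    & forall p, bitlen (arr s p) <= W].

Fixpoint expr_size (e : expr) : nat :=
  match e with
  | Lit k => bitlen k
  | Var _ | Get _ => 1
  | Bin _ a b => expr_size a + expr_size b
  end.

Fixpoint expr_cost (e : expr) (t : nat) : nat :=
  match e with
  | Lit k => 1 + bitlen t + 2 * bitlen k
  | Var i => bitlen i + bitlen t + 3
  | Get a => expr_cost a t + 3 * expr_size a + 4 * bitlen t + 3 * bitlen base + 3
  | Bin _ a b =>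
      expr_cost a t + expr_cost b t.+1 + 2 * bitlen t + bitlen t.+1 +
      2 * (expr_size a + expr_size b)
  end.

Definition assign_cost v e :=
  expr_cost e nvars + 2 * expr_size e + bitlen nvars + bitlen v + 1.

Fixpoint cmd_cost (c : cmd) : nat :=
  match c with
  | Assign v e => assign_cost v e
  | Put a e =>
      expr_cost a nvars + expr_cost e nvars.+1 + 3 * expr_size a +
      2 * expr_size e + 3 * bitlen nvars + bitlen nvars.+1 +
      3 * bitlen base + 1
  | ReadTo v => bitlen v + 1
  | Seq c1 c2 => cmd_cost c1 + cmd_cost c2
  | For v e c => assign_cost v e + 3 * bitlen v + 3 * expr_size e + 2 + cmd_cost c
  end.

Lemma bounded_var W s i : bounded W s -> bitlen (nth 0 (vars s) i) <= W.
Proof.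
case=> W_gt0 /(all_nthP 0) b_vars _; have [/b_vars //| ?] := ltnP i (size (vars s)).
by rewrite nth_default // /bitlen trunc_log0.
Qed.

Lemma bitlen_eval W s e : bounded W s -> bitlen (eval e s) <= expr_size e * W.
Proof.
move=> bs; elim: e => [k|i|a _|o a IHa b IHb] /=; rewrite ?mul1n.
- by case: bs => W_gt0 _ _; rewrite leq_pmulr.
- exact: bounded_var.
- by case: bs.
by rewrite mulnDl (leq_trans (bitlen_arith _ _ _)) // leq_add.
Qed.

Definition code_at (P : program) p (q : seq instr) :=
  exists l r, P = l ++ q ++ r /\ size l = p.

Lemma code_at_cat P p q1 q2 : code_at P p (q1 ++ q2) ->
  code_at P p q1 /\ code_at P (p + size q1) q2.
Proof.
case=> l [r [-> <-]]; split; first by exists l, (q2 ++ r); rewrite !catA.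
by exists (l ++ q1), r; rewrite !catA size_cat.
Qed.

Lemma code_at_cons P p i q : code_at P p (i :: q) ->
  onth P p = Some i /\ code_at P p.+1 q.
Proof.
case=> l [r [-> <-]]; split; first by rewrite onth_cat ltnn subnn.
by exists (rcons l i), r; rewrite cat_rcons size_rcons.
Qed.

Definition reach (P : program) (c c' : config) (K : nat) : Prop :=
  forall b t s, run P c' b t s -> exists t' s', t' <= K + t /\ run P c b t' s'.

Lemma reach_trans P c2 c1 c3 K1 K2 :
  reach P c1 c2 K1 -> reach P c2 c3 K2 -> reach P c1 c3 (K1 + K2).
Proof.
move=> r1 r2 b t s /r2[t2 [s2 [le2 /r1[t1 [s1 [le1 ?]]]]]].
by exists t1, s1; split=> //; lia.
Qed.

Lemma reach_le P c c' K K' : K <= K' -> reach P c c' K -> reach P c c' K'.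
Proof.
move=> leK r b t s /r[t' [s' [le' ?]]]; exists t', s'; split=> //; lia.
Qed.

Lemma reach_step P p i w m : onth P p = Some i -> ~~ is_halt i ->
  reach P (Config p w m) (instr_step i (Config p w m))
        (instr_cost i (Config p w m)).
Proof. by move=> Pi hi b t s r; do 2 eexists; split; last exact: run_step r. Qed.
Arguments reach_step [P p i] w m _ _.

Definition represents (m : memory) (s : state) : Prop :=
  (forall i, i < nvars -> m i = nth 0 (vars s) i) /\
  (forall p, m (base + p) = arr s p).

Lemma wf_expr_lt e t : wf_expr e t -> t < base.
Proof. by elim: e t => //= [i|o a IHa b _] t /andP[] // /IHa. Qed.

Lemma comp_exprP e t P p w m s W :
  nvars <= t -> wf_expr e t -> code_at P p (comp_expr e t) ->
  represents m s -> bounded W s ->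
  exists m', [/\ reach P (Config p w m)
                   (Config (p + size (comp_expr e t)) w m') (expr_cost e t * W),
                 m' t = eval e s
               & forall i, (i < t) || (base <= i) -> m' i = m i].
Proof.
move=> + + + rep bs; have W_gt0 : 0 < W by case: bs.
have cW c : c <= c * W by rewrite leq_pmulr.
elim: e t p m rep => [k|i|a IHa|o a IHa b IHb] t p m rep le_t /=.
- move=> t_lt /code_at_cons[P0 _]; have /= r0 := reach_step w m P0 isT.
  eexists; split.
  + rewrite addn1; apply: reach_le r0; rewrite addn0 (_ : bitlen 0 = 1) //.
    by have := cW (1 + bitlen t + 2 * bitlen k); lia.
  + by rewrite storeE eqxx /= addn0.
  by move=> i hi; rewrite storeE /=; case: eqP hi => // ->; lia.
- case/andP=> lt_i t_lt /code_at_cons[P0 _].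
  have /= r0 := reach_step w m P0 isT; eexists; split.
  + rewrite addn1; apply: reach_le r0; rewrite addn0 (_ : bitlen 0 = 1) //.
    rewrite (rep.1 _ lt_i) !mulnDl; have := bounded_var i bs.
    by have := cW (bitlen i); have := cW (bitlen t); have := cW 1; lia.
  + by rewrite addn0 storeE eqxx (rep.1 _ lt_i).
  by move=> j hj; rewrite storeE /=; case: eqP hj => // ->; lia.
- move=> wf /code_at_cat[Pa /code_at_cons[P0 /code_at_cons[P1 _]]].
  have [m' [ra m't m'E]] := IHa t p m rep le_t wf Pa.
  have lt_t := wf_expr_lt wf.
  have m'A q : m' (base + q) = arr s q by rewrite m'E ?rep.2 ?leq_addr ?orbT.
  have bt : base + eval a s == t = false by apply/eqP; lia.
  set x := eval a s in m't bt *.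
  pose m1 := store m' (ToDir t) (m' t + base).
  have m1t : m1 t = base + x by rewrite storeE eqxx m't addnC.
  have m1x : m1 (m1 t) = arr s x by rewrite m1t storeE /= bt m'A.
  have /= r1 := reach_step w m' P0 isT.
  have /= r2 := reach_step w m1 P1 isT.
  exists (store m1 (ToDir t) (m1 (m1 t) + 0)); split.
  + rewrite size_cat addnA addn2.
    apply: reach_le (reach_trans ra (reach_trans r1 r2)).
    rewrite m1x m1t m't !mulnDl addn0 [x + _]addnC (_ : bitlen 0 = 1) //.
    have := bitlen_arith OpAdd x base; rewrite /= [x + _]addnC.
    have := bitlen_eval a bs; rewrite -/x; have [_ _ /(_ x)] := bs.
    have := cW (bitlen t); have := cW (bitlen base); have := cW 1.
    by rewrite -?mulnA /=; move: (bitlen t) (bitlen base) => u v; lia.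
  + by rewrite storeE eqxx m1x addn0.
  by move=> i hi; rewrite !storeE /= -m'E //; case: eqP hi => // ->; lia.
case/andP=> wfa wfb /code_at_cat[Pa /code_at_cat[Pb /code_at_cons[P0 _]]].
have [m1 [r1 m1t m1E]] := IHa t p m rep le_t wfa Pa.
have rep1 : represents m1 s.
  split=> [i lt_i|q]; last by rewrite m1E ?rep.2 // leq_addr orbT.
  by rewrite m1E ?rep.1 // (leq_trans lt_i).
have [m2 [r2 m2t m2E]] := IHb t.+1 _ m1 rep1 (leqW le_t) wfb Pb.
have m2t' : m2 t = eval a s by rewrite m2E ?ltnSn.
have /= r3 := reach_step w m2 P0 isT.
have lt_t := wf_expr_lt wfa.
eexists; split.
- rewrite !size_cat !addnA addn1.
  apply: reach_le (reach_trans r1 (reach_trans r2 r3)); rewrite m2t m2t'.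
  have := bitlen_arith o (eval a s) (eval b s).
  have := bitlen_eval a bs; have := bitlen_eval b bs.
  have := cW (bitlen t); have := cW (bitlen t.+1).
  by rewrite !mulnDl -?mulnA; lia.
- by rewrite storeE eqxx m2t m2t'.
move=> i hi; rewrite !storeE /=; case: eqP hi => [->|_]; first by lia.
by move=> hi; rewrite m2E ?m1E //; case/orP: hi => [lt_i|->]; rewrite ?orbT // ltnS ltnW.
Qed.

Lemma base_add_eqF v q : v < nvars -> (base + q == v) = false.
Proof. by move=> lt_v; apply/gtn_eqF/(leq_trans lt_v)/(leq_trans _ (leq_addr q _)). Qed.

Lemma reach_assign v e P p s m W :
  v < nvars -> wf_expr e nvars ->
  code_at P p (comp_expr e nvars ++
               [:: Arith OpAdd (ToDir v) (Dir nvars) (Imm 0)]) ->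
  represents m s -> bounded W s ->
  exists m', represents m' (set_var s v (eval e s)) /\
    reach P (Config p (inp s) m)
      (Config (p + (size (comp_expr e nvars)).+1) (inp s) m')
      (assign_cost v e * W).
Proof.
move=> lt_v wf /code_at_cat[Pe /code_at_cons[P0 _]] rep bs.
have [m1 [r1 m1t m1E]] := comp_exprP (inp s) (leqnn _) wf Pe rep bs.
have /= r2 := reach_step (inp s) m1 P0 isT.
eexists; split; last first.
  rewrite addnS; apply: reach_le (reach_trans r1 r2).
  have W_gt0 : 0 < W by case: bs.
  have cW c : c <= c * W by rewrite leq_pmulr.
  have := bitlen_eval e bs; rewrite /assign_cost m1t addn0 (_ : bitlen 0 = 1) //.
  have := cW (bitlen nvars); have := cW (bitlen v); have := cW 1.
  by rewrite !mulnDl -?mulnA; move: (bitlen nvars) => u; lia.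
split=> [i lt_i|q]; rewrite storeE /= ?m1t ?addn0.
  by rewrite nth_set_nth /=; case: eqP => // _; rewrite m1E ?lt_i ?rep.1.
by rewrite base_add_eqF // m1E ?rep.2 // leq_addr orbT.
Qed.

Definition ok (c : cmd) (s s' : state) (X : nat) : Prop :=
  forall P p m, code_at P p (compile c p) -> represents m s ->
  exists m', represents m' s' /\
    reach P (Config p (inp s) m) (Config (p + size (compile c p)) (inp s') m')
      (cmd_cost c * X).

Lemma ok_le c s s' X Y : X <= Y -> ok c s s' X -> ok c s s' Y.
Proof.
move=> le_XY okc P p m Pc /(okc P p m Pc)[m' [rep r]]; exists m'; split=> //.
by apply: reach_le r; rewrite leq_mul2l le_XY orbT.
Qed.

Lemma ok_assign v e s W : wf_cmd (Assign v e) -> bounded W s ->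
  ok (Assign v e) s (set_var s v (eval e s)) W.
Proof.
case/andP=> lt_v wf bs P p m Pc rep; rewrite /= size_cat addn1.
exact: reach_assign.
Qed.

Lemma ok_read v s W : wf_cmd (ReadTo v) -> bounded W s ->
  bitlen (head 0 (inp s)) <= W -> ok (ReadTo v) s (read_var s v) W.
Proof.
move=> /= lt_v [W_gt0 _ _] bh P p m /code_at_cons[P0 _] rep.
have /= r := reach_step (inp s) m P0 isT; eexists; split; last first.
  rewrite addn1; apply: reach_le r.
  by rewrite mulnDl mul1n leq_add // leq_pmulr.
split=> [i lt_i|q]; rewrite storeE /=; first by rewrite nth_set_nth /= rep.1.
by rewrite base_add_eqF // rep.2.
Qed.

Lemma ok_put a e s W : wf_cmd (Put a e) -> bounded W s ->
  ok (Put a e) s (set_arr s (eval a s) (eval e s)) W.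
Proof.
case/andP=> wfa wfe bs P p m /=.
case/code_at_cat=> Pa /code_at_cat[Pe /code_at_cons[P0 /code_at_cons[P1 _]]] rep.
have [m1 [r1 m1t m1E]] := comp_exprP (inp s) (leqnn _) wfa Pa rep bs.
have rep1 : represents m1 s.
  split=> [i lt_i|q]; last by rewrite m1E ?rep.2 // leq_addr orbT.
  by rewrite m1E ?rep.1 // lt_i.
have [m2 [r2 m2t m2E]] := comp_exprP (inp s) (leqnSn _) wfe Pe rep1 bs.
have m2t' : m2 nvars = eval a s by rewrite m2E ?ltnSn.
have /= r3 := reach_step (inp s) m2 P0 isT.
set m3 := store _ _ _ in r3.
have m3t : m3 nvars = base + eval a s by rewrite storeE eqxx m2t' addnC.
have m3t' : m3 nvars.+1 = eval e s by rewrite storeE.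
have /= r4 := reach_step (inp s) m3 P1 isT.
exists (store m3 (ToInd nvars) (m3 nvars.+1 + 0)); split; last first.
  rewrite !size_cat !addnA addn2.
  apply: reach_le (reach_trans r1 (reach_trans r2 (reach_trans r3 r4))).
  have W_gt0 : 0 < W by case: bs.
  have cW c : c <= c * W by rewrite leq_pmulr.
  have := bitlen_eval e bs; have := bitlen_eval a bs.
  have := bitlen_arith OpAdd (eval a s) base.
  rewrite m3t m3t' m2t' addn0 (_ : bitlen 0 = 1) //= [_ + base]addnC.
  have := cW (bitlen nvars); have := cW (bitlen nvars.+1).
  have := cW (bitlen base); have := cW 1.
  rewrite !mulnDl -?mulnA.
  by move: (bitlen nvars) (bitlen nvars.+1) (bitlen base) => u v w; lia.
split=> [i lt_i|q]; rewrite storeE /= m3t ?m3t' ?addn0.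
  rewrite storeE /= eq_sym base_add_eqF // (ltn_eqF lt_i).
  by rewrite m2E ?m1E ?rep.1 ?lt_i // ltnS ltnW.
rewrite eqn_add2l; case: eqP => // _; rewrite storeE /=.
by rewrite m2E ?m1E ?rep.2 ?leq_addr ?orbT.
Qed.

Lemma ok_seq s2 c1 c2 s1 s3 X :
  ok c1 s1 s2 X -> ok c2 s2 s3 X -> ok (Seq c1 c2) s1 s3 X.
Proof.
move=> ok1 ok2 P p m /= /code_at_cat[P1 P2] rep.
have [m1 [rep1 r1]] := ok1 _ _ _ P1 rep.
have [m2 [rep2 r2]] := ok2 _ _ _ P2 rep1.
exists m2; split=> //; rewrite size_cat addnA mulnDl.
exact: reach_trans r1 r2.
Qed.

Lemma ok_for v e c s (f : nat -> state) W X :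
  wf_cmd (For v e c) -> bounded W s -> W <= X ->
  f (eval e s) = set_var s v (eval e s) ->
  (forall j, j <= eval e s -> nth 0 (vars (f j)) v = j) ->
  (forall j, j < eval e s -> ok c (set_var (f j.+1) v j) (f j) X) ->
  ok (For v e c) s (f 0) ((eval e s).+1 * X).
Proof.
case/and3P=> lt_v wfe wfc bs le_WX f_top f_v ok_c P p m /=.
set init := comp_expr e nvars ++ _; set p1 := p + size init.
set body := compile c _; case/code_at_cat=> Pi /code_at_cons[P0].
case/code_at_cons=> P1 /code_at_cat[Pb /code_at_cons[P2 _]] rep.
have [m0 [rep0 r0]] := reach_assign lt_v wfe Pi rep bs.
pose K := 3 * bitlen v + 3 * expr_size e + 2 + cmd_cost c.
have W_gt0 : 0 < W by case: bs.
have X_gt0 : 0 < X by apply: leq_trans le_WX.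
have cX k : k <= k * X by rewrite leq_pmulr.
pose pe := p1 + (size body).+3.
have loop j : j <= eval e s -> forall m1, represents m1 (f j) ->
    exists m', represents m' (f 0) /\
      reach P (Config p1 (inp (f j)) m1) (Config pe (inp (f 0)) m')
            (j.+1 * (K * X)).
  have bj i : i <= eval e s -> bitlen i <= expr_size e * X.
    move=> /leq_bitlen/leq_trans; apply; apply: leq_trans (bitlen_eval e bs) _.
    by rewrite leq_mul2l le_WX orbT.
  elim: j => [|j IHj] le_j m1 rep1.
    have /= r := reach_step (inp (f 0)) m1 P0 isT.
    have m1v : m1 v = 0 by rewrite rep1.1 ?f_v.
    rewrite m1v /= in r; exists m1; split=> //; apply: reach_le r.
    rewrite mul1n /K (_ : bitlen 0 = 1) // !mulnDl -?mulnA.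
    by have := cX (bitlen v); have := cX 1; lia.
  have /= r := reach_step (inp (f j.+1)) m1 P0 isT.
  have m1v : m1 v = j.+1 by rewrite rep1.1 ?f_v.
  rewrite m1v /= in r.
  have /= r' := reach_step (inp (f j.+1)) m1 P1 isT.
  rewrite m1v subn1 /= in r'.
  set m2 := store _ _ _ in r'.
  have rep2 : represents m2 (set_var (f j.+1) v j).
    split=> [i lt_i|q]; rewrite storeE /=.
      by rewrite nth_set_nth /=; case: eqP => // _; rewrite rep1.1.
    by rewrite base_add_eqF // rep1.2.
  have [m3 [rep3 r3]] := ok_c j le_j _ _ _ Pb rep2.
  have /= r4 := reach_step (inp (f j)) m3 P2 isT.
  have [m4 [rep4 r5]] := IHj (ltnW le_j) m3 rep3.
  exists m4; split=> //.
  apply: reach_le (reach_trans r (reach_trans r' (reach_trans r3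
    (reach_trans r4 r5)))).
  rewrite [j.+2 * _]mulSn !addnA leq_add2r /K !mulnDl -?mulnA.
  have := bj _ le_j; have := bj _ (ltnW le_j).
  rewrite (_ : bitlen 0 = 1) // (_ : bitlen 1 = 1) //.
  by have := cX (bitlen v); have := cX 1; lia.
rewrite -f_top in rep0.
have [m1 [rep1 r1]] := loop _ (leqnn _) _ rep0; exists m1; split=> //.
have ->: p + size (init ++ [:: Jzero (Dir v) pe, Arith OpSub (ToDir v) (Dir v)
    (Imm 1) & body ++ [:: Jzero (Imm 0) p1]]) = pe.
  by rewrite size_cat /= size_cat /= /pe /p1; lia.
rewrite f_top /= in r1.
have p1E : p1 = p + (size (comp_expr e nvars)).+1.
  by rewrite /p1 /init size_cat addn1.
rewrite -p1E in r0; apply: reach_le (reach_trans r0 r1).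
rewrite mulnCA (_ : _ + cmd_cost c = assign_cost v e + K); last by rewrite /K; lia.
rewrite [(_ + K) * _]mulnDl leq_add2r.
rewrite leq_mul2l (leq_trans le_WX) ?orbT //.
by rewrite leq_pmull.
Qed.

(** * Subset sums and exact covers *)

Definition bit (p b : nat) : bool := odd (p %/ 2 ^ b).

Definition bits m (p : nat) : {set 'I_m} := [set b : 'I_m | bit p b].

Lemma bit_leq p b : bit p b -> 2 ^ b <= p.
Proof.
by rewrite leqNgt /bit; apply: contraL => lt_pb; rewrite divn_small.
Qed.

Lemma bit_sub p b c : bit p b -> bit (p - 2 ^ b) c = bit p c && (c != b).
Proof.
move=> pb; have sub_div k d : (p - k * d) %/ d = p %/ d - k by exact: divnBMl.
have := sub_div 1 (2 ^ b); rewrite mul1n subn1 => sub_b.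
rewrite /bit; have [lt_cb|lt_bc|->] := ltngtP c b.
- have b_eq : 2 ^ b = (2 ^ (b - c)) * 2 ^ c by rewrite -expnD subnK // ltnW.
  rewrite b_eq sub_div oddB; first by rewrite oddX subn_eq0 leqNgt lt_cb andbT addbF.
  by rewrite leq_divRL ?expn_gt0 // -b_eq bit_leq.
- have c_eq : 2 ^ c = 2 ^ b * (2 * 2 ^ (c - b.+1)).
    by rewrite -expnS -expnD; congr expn; lia.
  rewrite c_eq !divnMA sub_b andbT; congr odd; congr (_ %/ _).
  by move: pb; rewrite /bit; case: (p %/ 2 ^ b) => // k /=; rewrite !divn2; lia.
by rewrite sub_b andbF; move: pb; rewrite /bit; case: (p %/ _) => //= k /negPf.
Qed.

Lemma bits_sub m p (b : 'I_m) : bit p b -> bits m (p - 2 ^ b) = bits m p :\ b.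
Proof.
by move=> pb; apply/setP=> c; rewrite !inE bit_sub // andbC -val_eqE.
Qed.

Lemma bits_full m : bits m (2 ^ m).-1 = setT.
Proof.
apply/setP=> b; rewrite !inE /bit.
have ->: (2 ^ m).-1 = (2 ^ (m - b)).-1 * 2 ^ b + (2 ^ b).-1.
  have : 2 ^ m = 2 ^ (m - b) * 2 ^ b by rewrite -expnD subnK // ltnW.
  by have := expn_gt0 2 (m - b); have := expn_gt0 2 b => /= *; nia.
rewrite divnMDl ?expn_gt0 // divn_small ?prednK ?expn_gt0 // addn0.
have: odd (2 ^ (m - b)) = false by rewrite oddX subn_eq0 leqNgt ltn_ord.
by have := expn_gt0 2 (m - b); case: (2 ^ _) => //= k _ /negbFE.
Qed.

Lemma card_bits m p : #|bits m p| = \sum_(b < m) bit p b.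
Proof.
by rewrite -sum1_card big_mkcond; apply: eq_bigr => b _; rewrite inE; case: bit.
Qed.

Section SubsetSums.
Variable m : nat.
Implicit Types (g : {set 'I_m} -> nat) (X Y : {set 'I_m}).

Definition pzeta g b X : nat :=
  \sum_(Y : {set 'I_m} | (Y \subset X) && (X :\: Y \subset [set i : 'I_m | i < b])) g Y.

Lemma pzeta0 g X : pzeta g 0 X = g X.
Proof.
rewrite /pzeta (big_pred1 X) // => Y.
have ->: [set i : 'I_m | i < 0] = set0 by apply/setP=> i; rewrite !inE.
by rewrite subset0 setD_eq0 /= eqEsubset.
Qed.

Lemma pzeta_full g X : pzeta g m X = \sum_(Y : {set 'I_m} | Y \subset X) g Y.
Proof.
apply: eq_bigl => Y; rewrite (_ : [set i : 'I_m | i < m] = setT) ?subsetT ?andbT //.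
by apply/setP=> i; rewrite !inE ltn_ord.
Qed.

Lemma pzetaS g (b : 'I_m) X :
  pzeta g b.+1 X = pzeta g b X + (b \in X) * pzeta g b (X :\ b).
Proof.
rewrite /pzeta (bigID (fun Y : {set 'I_m} => (b \in X) ==> (b \in Y))) /=.
congr addn.
  apply: eq_bigl => Y; rewrite -andbA; congr andb; apply/andP/idP.
    case=> /subsetP sXY bXY; apply/subsetP=> i iXY; have := sXY i iXY.
    rewrite !inE ltnS leq_eqVlt => /orP[/eqP/val_inj i_b|//].
    by move: iXY bXY; rewrite i_b inE => /andP[/negPf-> ->].
  move=> sXY; split.
    by apply: subset_trans sXY _; apply/subsetP=> i; rewrite !inE => /ltnW.
  apply/implyP=> bX; apply: contraTT isT => bY.
  by have := subsetP sXY b; rewrite !inE bX bY ltnn => /(_ isT).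
have [bX|bX] /= := boolP (b \in X); last by rewrite big_pred0 // => Y; rewrite andbF.
rewrite mul1n; apply: eq_bigl => Y; apply/andP/andP.
  case=> /andP[/subsetP sYX /subsetP sXY] bY; split; apply/subsetP=> i.
    by move=> iY; rewrite !inE sYX // andbT; apply: contraNneq bY => <-.
  have := sXY i; rewrite !inE => iXY /and3P[iY ib iX].
  by rewrite ltn_neqAle val_eqE ib -ltnS iXY // iY.
case=> /subsetP sYX /subsetP sXY; split; last first.
  by apply/negP=> /sYX; rewrite !inE eqxx.
apply/andP; split; apply/subsetP=> i; first by move/sYX; rewrite !inE => /andP[].
rewrite !inE ltnS leq_eqVlt val_eqE => /andP[iY iX].
by have [//|ib] := eqVneq; have := sXY i; rewrite !inE iY ib iX => /(_ isT).
Qed.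

Lemma pzeta_leS g (b : 'I_m) X : pzeta g b X <= pzeta g b.+1 X.
Proof. by rewrite pzetaS leq_addr. Qed.

Lemma pzeta_le g b X : b <= m -> pzeta g b X <= pzeta g m X.
Proof.
move=> le_bm; have mono d : b + d <= m -> pzeta g b X <= pzeta g (b + d) X.
  elim: d => [|d IHd]; rewrite ?addn0 // addnS => lt_m.
  exact: leq_trans (IHd (ltnW lt_m)) (pzeta_leS g (Ordinal lt_m) X).
by have := mono (m - b); rewrite subnKC //; apply.
Qed.

Definition union_power g k X : nat :=
  \sum_(t : {ffun 'I_k -> {set 'I_m}} | \bigcup_i t i == X) \prod_i g (t i).

Lemma pzeta_union_power g k X : pzeta (union_power g k) m X = pzeta g m X ^ k.
Proof.
rewrite !pzeta_full -[in RHS](card_ord k) -prod_nat_const.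
rewrite (bigA_distr_big (fun Y : {set 'I_m} => Y \subset X) (fun _ : 'I_k => g)).
rewrite /union_power (exchange_big_dep predT) //=.
rewrite [LHS](bigID (fun t : {ffun 'I_k -> {set 'I_m}} =>
  \bigcup_i t i \subset X)) /= [X in _ + X]big1 ?addn0; last first.
  move=> t /negPf tX; rewrite big_pred0 // => Y.
  by apply: contraFF tX => /andP[sYX /eqP->].
apply: eq_big => [t | t sX].
  apply/bigcupsP/ffun_onP => [tX i | tX i _]; first exact: tX.
  exact: tX.
rewrite (big_pred1 (\bigcup_i t i)) // => Y.
by rewrite /= andbC eq_sym; case: eqP => // ->.
Qed.

Section Weights.
Variables (v : pred {set 'I_m}) (z k : nat).
Let g X := v X * z ^ #|X|.

Lemma pzeta_weight_le X : 0 < z -> pzeta g m X <= 2 ^ m * z ^ m.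
Proof.
move=> z_gt0; rewrite pzeta_full.
apply: (@leq_trans (\sum_(Y : {set 'I_m}) z ^ m)).
  rewrite big_mkcond; apply: leq_sum => Y _; case: ifP => // _.
  rewrite /g -[z ^ m]mul1n leq_mul ?leq_b1 // leq_pexp2l //.
  by rewrite -[m in _ <= m]card_ord max_card.
by rewrite sum_nat_const -cardsT -powersetT card_powerset cardsT card_ord.
Qed.

Lemma sum_card_fibers (t : {ffun 'I_k -> {set 'I_m}}) :
  \sum_i #|t i| = \sum_x #|[set i | x \in t i]|.
Proof.
under eq_bigr do rewrite -sum1_card big_mkcond.
rewrite exchange_big; apply: eq_bigr => x _; rewrite -sum1_card [RHS]big_mkcond.
by apply: eq_bigr => i _; rewrite inE.
Qed.

Lemma cover_fiber_gt0 (t : {ffun 'I_k -> {set 'I_m}}) x :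
  \bigcup_i t i = setT -> 0 < #|[set i | x \in t i]|.
Proof.
move=> tT; have /bigcupP[i _ xi] : x \in \bigcup_i t i by rewrite tT inE.
by apply/card_gt0P; exists i; rewrite inE.
Qed.

Lemma cover_sum_card (t : {ffun 'I_k -> {set 'I_m}}) :
  \bigcup_i t i = setT -> m <= \sum_i #|t i|.
Proof.
move=> tT; rewrite sum_card_fibers -[m in m <= _]card_ord -sum1_card.
by apply: leq_sum => x _; apply: cover_fiber_gt0.
Qed.

Lemma exact_cover_fun (t : {ffun 'I_k -> {set 'I_m}}) :
  \bigcup_i t i = setT -> \sum_i #|t i| = m ->
  exists f : {ffun 'I_m -> 'I_k}, forall i, t i = f @^-1: [set i].
Proof.
move=> tT; rewrite sum_card_fibers => sum_m.
have card1 x : #|[set i | x \in t i]| == 1.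
  have : \sum_x (#|[set i | x \in t i]| - 1) == 0.
    rewrite sumnB => [|y _]; last exact: cover_fiber_gt0.
    by rewrite sum_m sum1_card card_ord subnn.
  rewrite sum_nat_eq0 => /forallP/(_ x)/=.
  by have := cover_fiber_gt0 x tT; case: #|_| => [|[]].
have /fin_all_exists[f fP] x : exists i, [set i | x \in t i] = [set i].
  exact/cards1P.
exists (finfun f) => i; apply/setP=> x; have /setP/(_ i) := fP x.
by rewrite !inE ffunE eq_sym.
Qed.

(* Covers have total size at least [m], so the residue modulo [z ^ m.+1] is the
   number of exact covers times [z ^ m]. *)
Lemma union_power_mod : (2 ^ m) ^ k < z ->
  reflect (exists f : {ffun 'I_m -> 'I_k}, forall i, v (f @^-1: [set i]))
          (union_power g k setT %% z ^ m.+1 != 0).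
Proof.
move=> z_big; have z_gt0 : 0 < z by apply: leq_ltn_trans z_big.
pose good (t : {ffun 'I_k -> {set 'I_m}}) :=
  [&& \bigcup_i t i == setT, [forall i, v (t i)] & \sum_i #|t i| == m].
have prodE (t : {ffun 'I_k -> {set 'I_m}}) :
    \prod_i g (t i) = [forall i, v (t i)] * z ^ (\sum_i #|t i|).
  rewrite expn_sum.
  have [/forallP vt | /forallPn[i /negPf vi]] := boolP [forall i, v (t i)].
    by rewrite mul1n; apply: eq_bigr => i _; rewrite /g vt mul1n.
  by rewrite mul0n (bigD1 i) //= /g vi !mul0n.
have ->: union_power g k setT %% z ^ m.+1 = #|good| * z ^ m.
  rewrite /union_power (bigID good) /=.
  have ->: \sum_(t : {ffun 'I_k -> {set 'I_m}} | (\bigcup_i t i == setT) && good t)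
      \prod_i g (t i) = #|good| * z ^ m.
    rewrite -sum_nat_const; apply: eq_big => [t | t /and4P[_ _ vt /eqP tm]].
      by rewrite /good !unfold_in; case: (_ == setT).
    by rewrite prodE vt tm mul1n.
  set rest := (X in _ + X); have /eqP rest0 : z ^ m.+1 %| rest.
    apply: dvdn_sum => t /andP[/eqP tT]; rewrite /good tT eqxx prodE /=.
    case: [forall i, _] => //=; rewrite ?mul0n ?dvdn0 // mul1n => ne_m.
    by rewrite dvdn_exp2l // ltn_neqAle eq_sym ne_m cover_sum_card.
  rewrite -modnDmr rest0 addn0 expnS -muln_modl modn_small //.
  apply: leq_ltn_trans z_big; rewrite (leq_trans (max_card _)) //.
  by rewrite card_ffun card_ord -cardsT -powersetT card_powerset cardsT card_ord.
rewrite muln_eq0 expn_eq0 negb_or (gtn_eqF z_gt0) andbT -lt0n.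
apply: (iffP card_gt0P) => [[t] | [f vf]].
  rewrite unfold_in => /and3P[/eqP tT /forallP vt /eqP tm].
  by have [f tf] := exact_cover_fun tT tm; exists f => i; rewrite -tf.
exists [ffun i => f @^-1: [set i]]; rewrite unfold_in; apply/and3P; split.
- apply/eqP/setP=> x; rewrite inE; apply/bigcupP; exists (f x) => //.
  by rewrite ffunE !inE.
- by apply/forallP=> i; rewrite ffunE.
apply/eqP; rewrite sum_card_fibers -[RHS]card_ord -sum1_card.
apply: eq_bigr => x _; apply/eqP/cards1P; exists (f x).
by apply/setP=> i; rewrite !inE ffunE !inE eq_sym.
Qed.

End Weights.
End SubsetSums.

Section ColoringsAsPartitions.
Variables (n : nat) (G : sgraph 'I_n).
Implicit Types (X : {set 'I_(n + n)}) (a b : 'I_n).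

Definition conflict a b X : bool :=
  (lshift n a \in X) &&
  (if adj G a b then lshift n b \in X else (a != b) && (rshift n b \in X)).

(* [X] stands for a pair of a color class (left copy) and a set of vertices
   dominating it (right copy). *)
Definition dominated_class X : bool :=
  ((X == set0) || [exists u, lshift n u \in X]) &&
  [forall a, forall b, ~~ conflict a b X].

Lemma dominator_coloringP l :
  (exists f : {ffun 'I_(n + n) -> 'I_(minn l n)},
     forall i, dominated_class (f @^-1: [set i])) <->
  has_dominator_coloring G l.
Proof.
split=> [[f vf] | [C [chi [[proper dom] le_l]]]].
  pose chi v := f (lshift n v); exists 'I_(minn l n), chi; split; last first.
    apply: leq_trans (max_card _) _; by rewrite card_ord geq_minl.
  have no_conf i a b : ~~ conflict a b (f @^-1: [set i]).
    by case/andP: (vf i) => _ /forallP/(_ a)/forallP/(_ b).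
  split=> [u v uv | v].
    have := no_conf (chi u) u v; rewrite /conflict !inE uv eqxx /=.
    by rewrite eq_sym.
  have /andP[/orP[/eqP X0|/existsP[u uX]] _] := vf (f (rshift n v)).
    by have := in_set0 (rshift n v); rewrite -X0 !inE eqxx.
  move: uX; rewrite !inE => /eqP uv.
  exists [set w | chi w == chi u]; first exact: imset_f.
  apply/subsetP=> w; rewrite !inE /chi uv => /eqP wv.
  have := no_conf (f (rshift n v)) w v.
  rewrite /conflict !inE wv !eqxx /= andbT adj_sym.
  by case: (adj G v w) => //= /negbNE.
pose I := [set chi v | v : 'I_n].
have le_I : #|I| <= minn l n.
  by rewrite leq_min le_l -[n in _ <= n]card_ord leq_imset_card.
have lt_idx v : index (chi v) (enum I) < minn l n.
  by apply: leq_trans le_I; rewrite cardE index_mem mem_enum imset_f.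
pose e v := Ordinal (lt_idx v).
have eE u v : e u = e v -> chi u = chi v.
  case=> /(congr1 (nth (chi u) (enum I))).
  by rewrite !nth_index ?mem_enum ?imset_f.
have /fin_all_exists[d dP] v :
    exists u, dominates G v [set w | chi w == chi u].
  by have [S /imsetP[u _ ->]] := dom v; exists u.
pose f : {ffun 'I_(n + n) -> 'I_(minn l n)} :=
  [ffun x => match split x with inl u => e u | inr v => e (d v) end].
have fl u : f (lshift n u) = e u by rewrite ffunE (unsplitK (inl u)).
have fr u : f (rshift n u) = e (d u) by rewrite ffunE (unsplitK (inr u)).
exists f => i; apply/andP; split.
  have [-> //|/set0Pn[x]] := eqVneq (f @^-1: [set i]) set0; rewrite !inE /= => fx.
  apply/existsP; move: fx; rewrite -[x]splitK.
  case: (split x) => [u|v] /=; first by exists u; rewrite !inE.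
  by rewrite fr -fl => fd; exists (d v); rewrite !inE.
apply/forallP=> a; apply/forallP=> b; apply/negP=> /andP[].
rewrite !inE fl => /eqP ea; case: ifP => ab.
  by rewrite fl -ea => /eqP/eE/esym/eqP; apply/negP; apply: proper.
rewrite fr -ea => /andP[ne_ab /eqP/eE ed].
have /subsetP/(_ a) := dP b; rewrite !inE ed eqxx adj_sym ab (negPf ne_ab).
by move/(_ isT).
Qed.

End ColoringsAsPartitions.

(** * The algorithm *)

Local Notation "a +e b" := (Bin OpAdd a b) (at level 50, left associativity).
Local Notation "a -e b" := (Bin OpSub a b) (at level 50, left associativity).
Local Notation "a *e b" := (Bin OpMul a b) (at level 40, left associativity).
Local Notation "a /e b" := (Bin OpDiv a b) (at level 40, left associativity).
Local Notation "c1 ;; c2" := (Seq c1 c2) (at level 90, right associativity).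

Local Notation vn := 0.
Local Notation vl := 1.
Local Notation vH := 2.
Local Notation vN := 3.
Local Notation vz := 4.
Local Notation vZ := 5.
Local Notation vk := 6.
Local Notation vi := 7.
Local Notation vj := 8.
Local Notation vp := 9.
Local Notation vq := 10.
Local Notation vr := 11.
Local Notation vx := 12.

Definition cell : expr := Get (Var vp).

Definition bit_expr (q : expr) : expr :=
  Var vp /e q -e Lit 2 *e (Var vp /e q /e Lit 2).

Definition pass (e : expr) : cmd := For vp (Var vN) (Put (Var vp) e).

Definition setup : cmd :=
  ReadTo vn ;; ReadTo vl ;;
  Assign vH (Lit 1) ;; For vi (Var vn) (Assign vH (Var vH *e Lit 2)) ;;
  Assign vN (Var vH *e Var vH) ;;
  Assign vz (Lit 2) ;; For vi (Var vn) (Assign vz (Var vz *e Var vN)) ;;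
  Assign vZ (Var vz) ;;
  For vi (Var vn +e Var vn) (Assign vZ (Var vZ *e Var vz)) ;;
  Assign vk (Var vl -e (Var vl -e Var vn)).

Definition weigh : cmd :=
  pass (Lit 1) ;; Assign vq (Lit 1) ;;
  For vi (Var vn +e Var vn)
    (pass (cell *e (Lit 1 +e bit_expr (Var vq) *e (Var vz -e Lit 1))) ;;
     Assign vq (Var vq *e Lit 2)).

Definition drop_empty_classes : cmd :=
  pass (cell *e ((Lit 1 -e (Lit 1 -e (Var vp -e Var vp /e Var vH *e Var vH)))
                 +e (Lit 1 -e Var vp))).

Definition drop_conflicts : cmd :=
  Assign vq (Lit 1) ;; Assign vr (Lit 1) ;;
  For vi (Var vn)
    (For vj (Var vn)
       (ReadTo vx ;;
        pass (cell *e (Lit 1 -e bit_expr (Var vq) *e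
          (Var vx *e bit_expr (Var vr) +e
           (Lit 1 -e (Var vx +e
              (Lit 1 -e ((Var vq -e Var vr) +e (Var vr -e Var vq))))) *e
           bit_expr (Var vr *e Var vH)))) ;;
        Assign vr (Var vr *e Lit 2) ;; Assign vx (Lit 0)) ;;
     Assign vr (Lit 1) ;; Assign vq (Var vq *e Lit 2)).

Definition lower_cell : expr :=
  bit_expr (Var vq) *e Get (Var vp -e bit_expr (Var vq) *e Var vq).

Definition zeta : cmd :=
  Assign vq (Lit 1) ;;
  For vi (Var vn +e Var vn)
    (pass (cell +e lower_cell) ;; Assign vq (Var vq *e Lit 2)).

Definition power : cmd :=
  For vp (Var vN)
    (Assign vx (Lit 1) ;; For vj (Var vk) (Assign vx (Var vx *e cell)) ;;
     Put (Var vp) (Var vx) ;; Assign vx (Lit 0)).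

Definition moebius : cmd :=
  For vi (Var vn +e Var vn)
    (Assign vq (Var vq /e Lit 2) ;; pass (cell -e lower_cell)).

Definition test : cmd :=
  let last := Get (Var vN -e Lit 1) in
  Assign vx (last -e last /e Var vZ *e Var vZ).

Definition dc_cmd : cmd :=
  setup ;; weigh ;; drop_empty_classes ;; drop_conflicts ;;
  zeta ;; power ;; moebius ;; test.

Definition dc_program : program :=
  let code := compile dc_cmd 0 in
  code ++ [:: Jzero (Dir vx) (size code).+2; Halt true; Halt false].

Lemma bitE p b : p %/ 2 ^ b - 2 * (p %/ 2 ^ b %/ 2) = bit p b.
Proof. by rewrite /bit; lia. Qed.

Lemma subn_divn_mul p d : p - p %/ d * d = p %% d.
Proof. by rewrite {1}(divn_eq p d) addnC addnK. Qed.

Lemma bounded_set_var W s v x :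
  bounded W s -> bitlen x <= W -> bounded W (set_var s v x).
Proof.
move=> bs bx; case: (bs) => W_gt0 _ b_arr; split=> //.
apply/(all_nthP 0) => i _; rewrite nth_set_nth /=.
by case: eqP => // _; apply: bounded_var.
Qed.

Lemma ok_pass e s F W :
  wf_cmd (pass e) -> bounded W s ->
  (forall p, p < nth 0 (vars s) vN -> bitlen (F p) <= W) ->
  (forall p B, p < nth 0 (vars s) vN -> (forall r, r <= p -> B r = arr s r) ->
     eval e (State (inp s) (set_nth 0 (vars s) vp p) B) = F p) ->
  ok (pass e) s
     (State (inp s) (set_nth 0 (vars s) vp 0)
        (fun p => if p < nth 0 (vars s) vN then F p else arr s p))
     ((nth 0 (vars s) vN).+1 * W).
Proof.
set N := nth 0 (vars s) vN => wf bs bF eF.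
pose f j := State (inp s) (set_nth 0 (vars s) vp j)
  (fun p => if j <= p < N then F p else arr s p).
have bp p : p <= N -> bitlen p <= W.
  by move=> /leq_bitlen/leq_trans; apply; apply: bounded_var.
apply: (@ok_for vp (Var vN) _ s f W W) => //.
- rewrite /f /set_var /= -/N; congr State; apply: functional_extensionality => p.
  by case: ltnP; rewrite ?andbF // andbT => lt_pN; rewrite leqNgt lt_pN.
- by move=> j _; rewrite nth_set_nth /=.
move=> j; rewrite /= -/N => lt_jN.
have bj : bounded W (set_var (f j.+1) vp j).
  apply: bounded_set_var; last exact/bp/ltnW.
  have [W_gt0 b_vars b_arr] := bounded_set_var vp bs (bp _ lt_jN).
  split=> // p /=; case: ifP => [/andP[_ lt_pN]|_]; [exact: bF | exact: b_arr].
case/and3P: wf => _ _ wf; have := ok_put wf bj.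
set s' := set_arr _ _ _; suff -> : s' = f j by [].
rewrite /s' /set_arr /f /set_var /= nth_set_nth set_set_nth /=.
congr State; apply: functional_extensionality => p; rewrite eF //.
  case: eqP => [->|ne_pj]; rewrite ?leqnn ?lt_jN //=.
  by rewrite [j <= p]leq_eqVlt eq_sym; case: eqP.
by move=> r le_rj; rewrite ltnNge le_rj.
Qed.

Section Instance.
Variables n l : nat.

Local Notation m := (n + n).
Local Notation k := (minn l n).
Local Notation N := (2 ^ (n + n)).
Definition radix := 2 * N ^ n.
Local Notation z := radix.
Local Notation Z := (radix ^ m.+1).
Definition value_bound := Z ^ n.+1.
Local Notation U := value_bound.
Definition word_size := bitlen l + bitlen U.
Local Notation W := word_size.
Definition time_unit := m.+1 * (m.+1 * (N.+1 * W)).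
Local Notation X := time_unit.

Lemma N_gt0 : 0 < N. Proof. by rewrite expn_gt0. Qed.

Lemma radix_gt0 : 0 < z. Proof. by rewrite muln_gt0 expn_gt0 N_gt0. Qed.

Lemma leNz : N <= z.
Proof.
rewrite /radix; case: n => [//|n']; apply: leq_trans (leq_pmull _ _) => //.
by rewrite -{1}[2 ^ _]expn1 leq_pexp2l ?expn_gt0.
Qed.

Lemma leZU : Z <= U.
Proof. by rewrite -{1}[Z]expn1 leq_pexp2l // expn_gt0 radix_gt0. Qed.

Lemma leXz_U c : c <= m.+1 -> z ^ c <= U.
Proof. by move=> le_c; apply: leq_trans leZU; rewrite leq_pexp2l ?radix_gt0. Qed.

Lemma lezU : z <= U. Proof. exact: (@leXz_U 1). Qed.

Lemma leNU : N <= U. Proof. exact: leq_trans leNz lezU. Qed.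

Lemma le2X_U c : c <= m -> 2 ^ c <= U.
Proof. by move=> le_c; apply: leq_trans leNU; rewrite leq_pexp2l. Qed.

Lemma lemU : m <= U.
Proof. by apply: leq_trans leNU; apply/ltnW/ltn_expl. Qed.

Lemma lenU : n <= U. Proof. exact: leq_trans (leq_addr _ _) lemU. Qed.

Lemma leHU : 2 ^ n <= U. Proof. by rewrite le2X_U ?leq_addr. Qed.

Lemma lekU : k <= U. Proof. exact: leq_trans (geq_minr _ _) lenU. Qed.

Lemma U_gt0 : 0 < U. Proof. exact: leq_trans N_gt0 leNU. Qed.

Lemma le2U : 1 < U.
Proof.
by apply: leq_trans lezU; rewrite /radix -[1.+1]muln1 leq_mul2l expn_gt0 N_gt0.
Qed.

Definition leUE := (U_gt0, lenU, leHU, leNU, lezU, leZU, lekU).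

Definition regular (x : nat) : bool := (x == l) || (x <= U).

Lemma bitlen_leU x : x <= U -> bitlen x <= W.
Proof. by move=> /leq_bitlen/leq_trans; apply; apply: leq_addl. Qed.

Lemma boundedI w rs A : all regular rs -> (forall p, A p <= U) ->
  bounded W (State w rs A).
Proof.
move=> rsP AP; split=> [||p]; last exact/bitlen_leU/AP.
  by rewrite /word_size addn_gt0.
apply: sub_all rsP => x /orP[/eqP->|/bitlen_leU //]; exact: leq_addr.
Qed.

Definition tab (F : nat -> nat) : nat -> nat := fun p => if p < N then F p else 0.

Lemma eq_tab F F' : (forall p, p < N -> F p = F' p) -> tab F = tab F'.
Proof.
by move=> eqF; apply: functional_extensionality => p; rewrite /tab; case: ifP => // /eqF.
Qed.

Lemma tab_le F : (forall p, p < N -> F p <= U) -> forall p, tab F p <= U.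
Proof. by move=> leF p; rewrite /tab; case: ifP => // /leF. Qed.

Lemma ok_pass_tab e w rs F F' :
  wf_cmd (pass e) -> nth 0 rs vN = N -> all regular rs ->
  (forall p, p < N -> F p <= U) -> (forall p, p < N -> F' p <= U) ->
  (forall p B, p < N -> (forall r, r <= p -> B r = F r) ->
     eval e (State w (set_nth 0 rs vp p) B) = F' p) ->
  ok (pass e) (State w rs (tab F)) (State w (set_nth 0 rs vp 0) (tab F'))
     (N.+1 * W).
Proof.
move=> wf rsN rsP leF leF' eF.
have := @ok_pass e (State w rs (tab F)) F' W wf; rewrite /= rsN.
have ->: (fun p => if p < N then F' p else tab F p) = tab F'.
  by apply: functional_extensionality => p; rewrite /tab; case: ltnP.
apply=> [|p lt_p|p B lt_p eqB].
- by apply: boundedI => //; apply: tab_le.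
- exact/bitlen_leU/leF'.
apply: eF => // r le_r; rewrite eqB // /tab (leq_ltn_trans le_r) //.
Qed.

Lemma leWX : W <= X.
Proof. by rewrite /time_unit 2?(leq_trans _ (leq_pmull _ _)) // leq_pmull. Qed.

Lemma le_pass_X : N.+1 * W <= X.
Proof. by rewrite /time_unit (leq_trans _ (leq_pmull _ _)) // leq_pmull. Qed.

Lemma le_passes_X : m.+1 * (N.+1 * W) <= X.
Proof. exact: leq_pmull. Qed.

Local Notation rs i j p q r x :=
  [:: n; l; 2 ^ n; N; z; Z; k; i; j; p; q; r; x].

Lemma ok_setup w :
  ok setup (State [:: n, l & w] (nseq 13 0) (fun=> 0))
     (State w (rs 0 0 0 0 0 0) (fun=> 0)) X.
Proof.
have W_gt0 : 0 < W by rewrite /word_size addn_gt0.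
have leW := ok_le leWX.
apply: ok_seq.
  apply/leW/ok_read => //.
  exact/bitlen_leU/lenU.
rewrite /read_var /=; apply: ok_seq.
  apply/leW/ok_read => //; last exact: leq_addr.
  by apply: boundedI => //=; rewrite /regular ?leUE ?orbT.
rewrite /read_var /=.
have regP rs' : all regular rs' -> bounded W (State w rs' (fun=> 0)).
  by move=> rsP; apply: boundedI.
apply: ok_seq.
  by apply/leW/ok_assign/regP => //=; rewrite /regular ?leUE ?eqxx ?orbT.
rewrite /set_var /=; apply: ok_seq.
  pose f j := State w [:: n; l; 2 ^ (n - j); 0; 0; 0; 0; j; 0; 0; 0; 0; 0] (fun=> 0).
  apply: ok_le (@ok_for vi (Var vn) _ _ f W W _ _ _ _ _ _) => //.
  - by rewrite /= (leq_trans _ le_passes_X) // leq_mul // ?ltnS ?leq_addr ?leq_pmull.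
  - by apply/regP; rewrite /= /regular ?leUE ?eqxx ?orbT.
  - by rewrite /f /set_var /= subnn.
  move=> j /= lt_jn; have := @ok_assign vH (Var vH *e Lit 2) _ W.
  move=> /(_ (set_var (f j.+1) vi j)).
  rewrite /f /set_var /= -expnSr subnSK //; apply=> //.
  apply/regP => /=.
  by rewrite /regular ?leUE ?eqxx ?(leq_trans (ltnW lt_jn) lenU) ?le2X_U ?orbT //; lia.
rewrite /=; apply: ok_seq.
  by apply/leW/ok_assign/regP => //=; rewrite /regular subn0 ?leUE ?eqxx ?orbT.
rewrite /set_var /= subn0 -expnD; apply: ok_seq.
  by apply/leW/ok_assign/regP => //=; rewrite /regular ?leUE ?eqxx ?orbT.
rewrite /set_var /=; apply: ok_seq.
  pose f j := State w [:: n; l; 2 ^ n; N; 2 * N ^ (n - j); 0; 0; j; 0; 0; 0; 0; 0] (fun=> 0).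
  apply: ok_le (@ok_for vi (Var vn) _ _ f W W _ _ _ _ _ _) => //.
  - by rewrite /= (leq_trans _ le_passes_X) // leq_mul // ?ltnS ?leq_addr ?leq_pmull.
  - by apply/regP; rewrite /= /regular ?leUE ?eqxx le2U ?orbT.
  - by rewrite /f /set_var /= subnn.
  move=> j /= lt_jn; have := @ok_assign vz (Var vz *e Var vN) _ W.
  move=> /(_ (set_var (f j.+1) vi j)).
  rewrite /f /set_var /= -mulnA -expnSr subnSK //; apply=> //.
  apply/regP => /=.
  have le_z : 2 * N ^ (n - j.+1) <= U.
    by apply: leq_trans lezU; rewrite leq_mul2l leq_pexp2l ?N_gt0 ?leq_subr.
  by rewrite /regular ?leUE ?eqxx ?(leq_trans (ltnW lt_jn) lenU) ?le_z ?orbT.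
rewrite /= subn0 -/radix; apply: ok_seq.
  by apply/leW/ok_assign/regP => //=; rewrite /regular ?leUE ?eqxx ?orbT.
rewrite /set_var /=; apply: ok_seq.
  pose f j := State w [:: n; l; 2 ^ n; N; z; z ^ (m - j).+1; 0; j; 0; 0; 0; 0; 0] (fun=> 0).
  apply: ok_le (@ok_for vi (Var vn +e Var vn) _ _ f W W _ _ _ _ _ _) => //.
  - by rewrite /= (leq_trans _ le_passes_X) // leq_mul // ?ltnS ?leq_addr ?leq_pmull.
  - by apply/regP; rewrite /= /regular ?leUE ?eqxx ?orbT.
  - by rewrite /f /set_var /= subnn.
  move=> j /= lt_jn; have := @ok_assign vZ (Var vZ *e Var vz) _ W.
  move=> /(_ (set_var (f j.+1) vi j)).
  rewrite /f /set_var /= -expnSr subnSK //; apply=> //.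
  apply/regP => /=.
  have le_z : z ^ (m - j) <= U by rewrite leXz_U // (leq_trans (leq_subr _ _)).
  by rewrite /regular ?leUE ?eqxx ?(leq_trans (ltnW lt_jn) lemU) ?le_z ?orbT.
rewrite /= subn0; have := @ok_assign vk (Var vl -e (Var vl -e Var vn))
  (State w [:: n; l; 2 ^ n; N; z; Z; 0; 0; 0; 0; 0; 0; 0] (fun=> 0)) W.
rewrite /set_var /= (_ : l - (l - n) = k); last by lia.
move=> okk; apply/leW/okk => //; apply/regP => /=.
by rewrite /regular ?leUE ?eqxx ?orbT.
Qed.

Definition weight b p := \sum_(c < b) bit p c.

Lemma weight_le b p : weight b p <= b.
Proof.
rewrite -[b in _ <= b]card_ord -sum1_card; apply: leq_sum => c _; exact: leq_b1.
Qed.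

Lemma ok_weigh w :
  ok weigh (State w (rs 0 0 0 0 0 0) (fun=> 0))
     (State w (rs 0 0 0 N 0 0) (tab (fun p => z ^ weight m p))) X.
Proof.
have tab0 : (fun=> 0) = tab (fun=> 0).
  by apply: functional_extensionality => p; rewrite /tab if_same.
rewrite tab0; apply: ok_seq.
  apply: (ok_le le_pass_X); apply: (@ok_pass_tab _ _ _ _ (fun=> 1)) => //=.
  - by rewrite /regular ?leUE ?eqxx ?orbT.
  - by move=> p _; apply: U_gt0.
rewrite /=; apply: ok_seq.
  apply/(ok_le leWX)/ok_assign => //; apply: boundedI => /=.
    by rewrite /regular ?leUE ?eqxx ?orbT.
  by apply: tab_le => p _; apply: U_gt0.
rewrite /set_var /=.
pose f i := State w (rs i 0 0 (2 ^ (m - i)) 0 0) (tab (fun p => z ^ weight (m - i) p)).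
have -> : State w (rs 0 0 0 N 0 0) (tab (fun p => z ^ weight m p)) = f 0.
  by rewrite /f subn0.
apply: (ok_le le_passes_X).
apply: (@ok_for vi (Var vn +e Var vn) _ _ f W (N.+1 * W)) => //.
- apply: boundedI => /=; first by rewrite /regular ?leUE ?eqxx ?orbT.
  by apply: tab_le => p _; apply: U_gt0.
- by rewrite leq_pmull.
- rewrite /f /set_var /= subnn; congr State; apply: eq_tab => p _.
  by rewrite /weight big_ord0.
move=> j /= lt_jm; rewrite /f /set_var /= -(subnSK lt_jm); set b := m - j.+1.
have le_b : b < m by rewrite /b; lia.
have regP : all regular (rs j 0 0 (2 ^ b) 0 0).
  by rewrite /= /regular ?leUE ?eqxx ?(leq_trans (ltnW lt_jm) lemU) ?le2X_U ?orbT // ltnW.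
apply: ok_seq.
  apply: (@ok_pass_tab _ _ _ _ (fun p => z ^ weight b.+1 p)) => //.
  - by move=> p _; rewrite leXz_U // (leq_trans (weight_le _ _)) // ltnW // ltnS ltnW.
  - by move=> p _; rewrite leXz_U // (leq_trans (weight_le _ _)) // ltnW.
  move=> p B lt_p eqB; rewrite /= bitE eqB //.
  rewrite /weight big_ord_recr /= expnD; congr muln.
  by case: bit; rewrite ?mul1n ?mul0n ?expn1 // subnKC ?radix_gt0.
rewrite /= [2 ^ b.+1]expnSr; apply: (@ok_le _ _ _ W); first exact: leq_pmull.
apply: ok_assign => //.
apply: boundedI => //; apply: tab_le => p _.
by rewrite leXz_U // (leq_trans (weight_le _ _)) // ltnW.
Qed.

Definition nonempty_class p : nat := (1 - (1 - p %% 2 ^ n)) + (1 - p).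

Lemma nonempty_class_le1 p : nonempty_class p <= 1.
Proof.
rewrite /nonempty_class; case: p => [|p]; first by rewrite mod0n.
by rewrite subSS sub0n addn0 leq_subr.
Qed.

Lemma ok_drop_empty_classes w :
  ok drop_empty_classes (State w (rs 0 0 0 N 0 0) (tab (fun p => z ^ weight m p)))
     (State w (rs 0 0 0 N 0 0)
        (tab (fun p => z ^ weight m p * nonempty_class p))) X.
Proof.
have wU p : z ^ weight m p <= U by rewrite leXz_U // leqW // weight_le.
apply: (ok_le le_pass_X).
apply: (@ok_pass_tab _ _ _ _ (fun p => z ^ weight m p * nonempty_class p)) => //.
- by rewrite /= /regular ?leUE ?eqxx ?orbT.
- by move=> p _; rewrite (leq_trans _ (wU p)) // -[X in _ <= X]muln1 leq_mul2l
    nonempty_class_le1 orbT.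
move=> p B lt_p eqB; by rewrite /= eqB // /nonempty_class subn_divn_mul.
Qed.

Section Conflicts.
Variable w : seq nat.
Hypothesis w_le1 : forall s, nth 0 w s <= 1.

Definition conflict_bits s p : bool :=
  bit p (s %/ n) && (if nth 0 w s == 1 then bit p (s %% n)
                     else (s %/ n != s %% n) && bit p (n + s %% n)).

Definition sieved r p : nat :=
  z ^ weight m p * nonempty_class p * \prod_(s < r) ~~ conflict_bits s p.

Lemma sieved_le r p : sieved r p <= U.
Proof.
apply: (@leq_trans (z ^ weight m p)); last by rewrite leXz_U // leqW // weight_le.
rewrite -[X in _ <= X]muln1 /sieved -mulnA leq_mul2l -[X in _ <= X]mul1n.
apply/orP; right; apply: leq_mul; first exact: nonempty_class_le1.
by elim/big_rec: _ => // s y _; case: conflict_bits; rewrite ?mul1n.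
Qed.

Lemma ok_drop_conflicts :
  ok drop_conflicts
     (State w (rs 0 0 0 N 0 0) (tab (fun p => z ^ weight m p * nonempty_class p)))
     (State (drop (n * n) w) (rs 0 0 0 (2 ^ n) 1 0) (tab (sieved (n * n)))) X.
Proof.
have -> : tab (fun p => z ^ weight m p * nonempty_class p) = tab (sieved 0).
  by apply: eq_tab => p _; rewrite /sieved big_ord0 muln1.
have tabP r p : tab (sieved r) p <= U by apply: tab_le => q _; apply: sieved_le.
have leWN : W <= N.+1 * W by apply: leq_pmull.
apply: ok_seq.
  apply/(ok_le leWX)/ok_assign => //; apply: boundedI => //=.
  by rewrite /regular ?leUE ?eqxx ?orbT.
rewrite /set_var /=; apply: ok_seq.
  apply/(ok_le leWX)/ok_assign => //; apply: boundedI => //=.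
  by rewrite /regular ?leUE ?eqxx ?orbT.
rewrite /set_var /=.
pose f i := State (drop ((n - i) * n) w) (rs i 0 0 (2 ^ (n - i)) 1 0)
  (tab (sieved ((n - i) * n))).
have -> : State (drop (n * n) w) (rs 0 0 0 (2 ^ n) 1 0) (tab (sieved (n * n))) = f 0.
  by rewrite /f subn0.
apply: (@ok_le _ _ _ (n.+1 * (n.+1 * (N.+1 * W)))).
  by rewrite /time_unit leq_mul ?leq_mul // ltnS leq_addr.
apply: (@ok_for vi (Var vn) _ _ f W (n.+1 * (N.+1 * W))) => //.
- by apply: boundedI => //=; rewrite /regular ?leUE ?eqxx ?orbT.
- exact: leq_trans leWN (leq_pmull _ _).
- by rewrite /f /set_var /= subnn mul0n drop0.
move=> i /= lt_in; rewrite /f /set_var /= -(subnSK lt_in); set a := n - i.+1.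
have lt_an : a < n by rewrite /a; lia.
have iU : i <= U by rewrite (leq_trans (ltnW lt_in)) ?lenU.
have aU : 2 ^ a <= U by rewrite le2X_U // (leq_trans (ltnW lt_an)) ?leq_addr.
pose g j := State (drop (a * n + (n - j)) w) (rs i j 0 (2 ^ a) (2 ^ (n - j)) 0)
  (tab (sieved (a * n + (n - j)))).
apply: (@ok_seq (g 0)).
  apply: (@ok_for vj (Var vn) _ _ g W (N.+1 * W)) => //.
  - by apply: boundedI => //=; rewrite /regular ?leUE ?iU ?aU ?eqxx ?orbT.
  - by rewrite /g /set_var /= subnn addn0.
  move=> j /= lt_jn; rewrite /g /set_var /= -(subnSK lt_jn); set b := n - j.+1.
  have lt_bn : b < n by rewrite /b; lia.
  have jU : j <= U by rewrite (leq_trans (ltnW lt_jn)) ?lenU.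
  have bU : 2 ^ b <= U by rewrite le2X_U // (leq_trans (ltnW lt_bn)) ?leq_addr.
  have b1U : 2 ^ b.+1 <= U by rewrite le2X_U // (leq_trans lt_bn) ?leq_addr.
  set s := a * n + b; have n_gt0 : 0 < n by apply: leq_trans lt_bn.
  have sn : s %/ n = a by rewrite divnMDl // divn_small ?addn0.
  have sm : s %% n = b by rewrite modnMDl modn_small.
  have xU : nth 0 w s <= U by rewrite (leq_trans (w_le1 s)) ?U_gt0.
  have head_w : head 0 (drop s w) = nth 0 w s by rewrite -nth0 nth_drop addn0.
  have behead_w : behead (drop s w) = drop s.+1 w by rewrite -drop1 drop_drop add1n.
  apply: ok_seq.
    apply/(ok_le leWN)/ok_read => //; last by rewrite head_w bitlen_leU.
    by apply: boundedI => //=; rewrite /regular ?leUE ?iU ?aU ?jU ?bU ?eqxx ?orbT.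
  rewrite /read_var /= head_w behead_w addnS; apply: ok_seq.
    apply: (@ok_pass_tab _ _ _ _ (sieved s.+1)) => //.
    - by rewrite /= /regular ?leUE ?iU ?aU ?jU ?bU ?xU ?eqxx ?orbT.
    - by move=> p _; apply: sieved_le.
    - by move=> p _; apply: sieved_le.
    move=> p B lt_p eqB; rewrite /= -expnD [b + n]addnC !bitE eqB //.
    rewrite {2}/sieved big_ord_recr /= mulnA; congr muln.
    rewrite /conflict_bits sn sm; have := w_le1 s.
    have eq_ab : (2 ^ a - 2 ^ b + (2 ^ b - 2 ^ a) == 0) = (a == b).
      by rewrite addn_eq0 !subn_eq0 -eqn_leq eqn_exp2l.
    move: eq_ab (bit p a) (bit p b) (bit p (n + b)).
    case: (_ - _ + _) => [|d] /= <-; case: (nth 0 w s) => [|[|//]] [] [] [] //=.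
  rewrite /=; apply: ok_seq.
    apply/(ok_le leWN)/ok_assign => //; apply: boundedI => //=.
    by rewrite /regular ?leUE ?iU ?aU ?jU ?bU ?xU ?eqxx ?orbT.
  rewrite /set_var /= -[2 ^ b * 2]expnSr.
  apply/(ok_le leWN)/ok_assign => //; apply: boundedI => //=.
  by rewrite /regular ?leUE ?iU ?aU ?jU ?b1U ?xU ?eqxx ?orbT.
have leWn : W <= n.+1 * (N.+1 * W) by apply: leq_trans leWN (leq_pmull _ _).
rewrite /g subn0 mulSnr; apply: ok_seq.
  apply/(ok_le leWn)/ok_assign => //; apply: boundedI => //=.
  by rewrite /regular ?leUE ?iU ?aU ?eqxx ?orbT.
rewrite /set_var /= [2 ^ a.+1]expnSr; apply/(ok_le leWn)/ok_assign => //.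
by apply: boundedI => //=; rewrite /regular ?leUE ?iU ?aU ?eqxx ?orbT.
Qed.

End Conflicts.

Section Transforms.
Variables (w : seq nat) (g : {set 'I_m} -> nat).
Hypothesis g_le : forall Y, pzeta g m Y <= Z.

Lemma pzeta_leU b Y : b <= m -> pzeta g b Y <= U.
Proof.
by move=> le_b; rewrite (leq_trans (pzeta_le _ _ _)) // (leq_trans (g_le _)) ?leZU.
Qed.

Lemma pzeta_powU c Y : c <= n -> pzeta g m Y ^ c <= U.
Proof.
move=> le_c; apply: (@leq_trans (Z ^ c)).
  by case: c {le_c} => // c; rewrite leq_exp2r.
by rewrite leq_pexp2l ?expn_gt0 ?radix_gt0 // leqW.
Qed.

Lemma lower_pzeta (h : {set 'I_m} -> nat) (b : 'I_m) p (B : nat -> nat) :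
  (forall r, r <= p -> B r = pzeta h b (bits m r)) ->
  bit p b * B (p - bit p b * 2 ^ b) =
  (b \in bits m p) * pzeta h b (bits m p :\ b).
Proof.
move=> eqB; rewrite inE; case pb: (bit p b); rewrite ?mul0n // !mul1n.
by rewrite eqB ?leq_subr // bits_sub.
Qed.

Lemma ok_zeta :
  ok zeta (State w (rs 0 0 0 (2 ^ n) 1 0) (tab (fun p => g (bits m p))))
     (State w (rs 0 0 0 N 1 0) (tab (fun p => pzeta g m (bits m p)))) X.
Proof.
have -> : tab (fun p => g (bits m p)) = tab (fun p => pzeta g 0 (bits m p)).
  by apply: eq_tab => p _; rewrite pzeta0.
have tabP b p : b <= m -> tab (fun p => pzeta g b (bits m p)) p <= U.
  by move=> le_b; apply: tab_le => q _; apply: pzeta_leU.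
have leWN : W <= N.+1 * W by apply: leq_pmull.
apply: ok_seq.
  apply/(ok_le leWX)/ok_assign => //; apply: boundedI => [|p]; last exact: tabP.
  by rewrite /= /regular ?leUE ?eqxx ?orbT.
rewrite /set_var /=.
pose f i := State w (rs i 0 0 (2 ^ (m - i)) 1 0)
  (tab (fun p => pzeta g (m - i) (bits m p))).
have -> : State w (rs 0 0 0 N 1 0) (tab (fun p => pzeta g m (bits m p))) = f 0.
  by rewrite /f subn0.
apply: (ok_le le_passes_X).
apply: (@ok_for vi (Var vn +e Var vn) _ _ f W (N.+1 * W)) => //.
- apply: boundedI => [|p]; last exact: tabP.
  by rewrite /= /regular ?leUE ?eqxx ?orbT.
- by rewrite /f /set_var /= subnn.
move=> j /= lt_jm; rewrite /f /set_var /= -(subnSK lt_jm); set b := m - j.+1.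
have lt_b : b < m by rewrite /b; lia.
have jU : j <= U by rewrite (leq_trans (ltnW lt_jm)) ?lemU.
have bU : 2 ^ b <= U by rewrite le2X_U // ltnW.
apply: ok_seq.
  apply: (@ok_pass_tab _ _ _ _ (fun p => pzeta g b.+1 (bits m p))) => //.
  - by rewrite /= /regular ?leUE ?jU ?bU ?eqxx ?orbT.
  - by move=> p _; apply: pzeta_leU; apply: ltnW.
  - by move=> p _; apply: pzeta_leU.
  move=> p B lt_p eqB; rewrite /= !bitE eqB // (pzetaS g (Ordinal lt_b)).
  by rewrite -(@lower_pzeta g (Ordinal lt_b) p B).
rewrite /= [2 ^ b.+1]expnSr; apply/(ok_le leWN)/ok_assign => //.
apply: boundedI => [|p]; last exact: tabP.
by rewrite /= /regular ?leUE ?jU ?bU ?eqxx ?orbT.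
Qed.

Lemma ok_power :
  ok power (State w (rs 0 0 0 N 1 0) (tab (fun p => pzeta g m (bits m p))))
     (State w (rs 0 0 0 N 1 0) (tab (fun p => pzeta g m (bits m p) ^ k))) X.
Proof.
pose F j p := pzeta g m (bits m p) ^ (if j <= p then k else 1).
have lek : k <= n by rewrite geq_minr.
have FU j p : F j p <= U.
  rewrite /F; case: ifP => _; first exact: pzeta_powU.
  by rewrite expn1 pzeta_leU.
have tabP j p : tab (F j) p <= U by apply: tab_le => q _; apply: FU.
pose f j := State w (rs 0 0 j N 1 0) (tab (F j)).
have -> : State w (rs 0 0 0 N 1 0) (tab (fun p => pzeta g m (bits m p) ^ k)) = f 0.
  by [].
have -> : tab (fun p => pzeta g m (bits m p)) = tab (F N).
  by apply: eq_tab => p lt_p; rewrite /F leqNgt lt_p expn1.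
apply: (@ok_le _ _ _ (N.+1 * (k.+1 * W))).
  rewrite mulnCA (leq_trans _ le_passes_X) // leq_mul // ltnS.
  by rewrite (leq_trans lek) ?leq_addr.
apply: (@ok_for vp (Var vN) _ _ f W (k.+1 * W)) => //.
- by apply: boundedI => //=; rewrite /regular ?leUE ?eqxx ?orbT.
- exact: leq_pmull.
move=> j /= lt_jN; rewrite /f /set_var /=.
have jU : j <= U by rewrite (leq_trans (ltnW lt_jN)) ?leNU.
have leWk : W <= k.+1 * W by apply: leq_pmull.
apply: ok_seq.
  apply/(ok_le leWk)/ok_assign => //; apply: boundedI => //=.
  by rewrite /regular ?leUE ?jU ?eqxx ?orbT.
rewrite /set_var /=.
pose h i := State w (rs 0 i j N 1 (pzeta g m (bits m j) ^ (k - i))) (tab (F j.+1)).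
apply: (@ok_seq (h 0)).
  apply: (@ok_for vj (Var vk) _ _ h W W) => //.
  - by apply: boundedI => //=; rewrite /regular ?leUE ?jU ?eqxx ?orbT.
  - by rewrite /h /set_var /= subnn.
  move=> i /= lt_ik; rewrite /h /set_var /= -(subnSK lt_ik) [pzeta _ _ _ ^ _.+1]expnSr.
  have -> : pzeta g m (bits m j) = tab (F j.+1) j.
    by rewrite /tab lt_jN /F ltnn expn1.
  apply: ok_assign => //; apply: boundedI => //=.
  have xU : tab (F j.+1) j ^ (k - i.+1) <= U.
    rewrite /tab lt_jN /F ltnn expn1 pzeta_powU //.
    by rewrite (leq_trans (leq_subr _ _)).
  have iU : i <= U by rewrite (leq_trans (ltnW lt_ik)) ?lekU.
  by rewrite /regular ?leUE ?jU ?iU ?xU ?eqxx ?orbT.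
have xU : pzeta g m (bits m j) ^ k <= U by apply: pzeta_powU.
rewrite /h subn0; apply: ok_seq.
  apply/(ok_le leWk)/ok_put => //; apply: boundedI => //=.
  by rewrite /regular ?leUE ?jU ?xU ?eqxx ?orbT.
rewrite /set_arr /=.
have -> : (fun p => if p == j then pzeta g m (bits m j) ^ k else tab (F j.+1) p) =
    tab (F j).
  apply: functional_extensionality => p; rewrite /tab /F.
  have [->|ne_pj] := eqVneq p j; first by rewrite lt_jN leqnn.
  by rewrite [j <= p]leq_eqVlt eq_sym (negPf ne_pj).
apply/(ok_le leWk)/ok_assign => //; apply: boundedI => //=.
by rewrite /regular ?leUE ?jU ?xU ?eqxx ?orbT.
Qed.

Lemma ok_moebius :
  ok moebius (State w (rs 0 0 0 N 1 0) (tab (fun p => pzeta g m (bits m p) ^ k)))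
     (State w (rs 0 0 0 1 1 0) (tab (fun p => union_power g k (bits m p)))) X.
Proof.
set h := union_power g k.
have hU b Y : b <= m -> pzeta h b Y <= U.
  move=> le_b; rewrite (leq_trans (pzeta_le _ _ _)) // pzeta_union_power.
  by rewrite pzeta_powU ?geq_minr.
have tabP b p : b <= m -> tab (fun p => pzeta h b (bits m p)) p <= U.
  by move=> le_b; apply: tab_le => q _; apply: hU.
pose f i := State w (rs i 0 0 (2 ^ i) 1 0) (tab (fun p => pzeta h i (bits m p))).
have -> : State w (rs 0 0 0 1 1 0) (tab (fun p => h (bits m p))) = f 0.
  by rewrite /f; congr State; apply: eq_tab => p _; rewrite pzeta0.
have -> : tab (fun p => pzeta g m (bits m p) ^ k) =
    tab (fun p => pzeta h m (bits m p)).
  by apply: eq_tab => p _; rewrite pzeta_union_power.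
have leWN : W <= N.+1 * W by apply: leq_pmull.
apply: (ok_le le_passes_X).
apply: (@ok_for vi (Var vn +e Var vn) _ _ f W (N.+1 * W)) => //.
  apply: boundedI => [|p]; last exact: tabP.
  by rewrite /= /regular ?leUE ?eqxx ?orbT.
move=> j /= lt_jm; rewrite /f /set_var /=.
have jU : j <= U by rewrite (leq_trans (ltnW lt_jm)) ?lemU.
have j1U : 2 ^ j.+1 <= U by rewrite le2X_U.
have j2U : 2 ^ j <= U by rewrite le2X_U // ltnW.
apply: ok_seq.
  apply/(ok_le leWN)/ok_assign => //; apply: boundedI => [|p]; last exact: tabP.
  by rewrite /= /regular ?leUE ?jU ?j1U ?eqxx ?orbT.
rewrite /set_var /= [2 ^ j.+1]expnSr mulnK //.
apply: (@ok_pass_tab _ _ _ _ (fun p => pzeta h j (bits m p))) => //.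
- by rewrite /= /regular ?leUE ?jU ?j2U ?eqxx ?orbT.
- by move=> p _; apply: hU.
- by move=> p _; apply/hU/ltnW.
move=> p B lt_p eqB; rewrite /= !bitE eqB // (pzetaS h (Ordinal lt_jm)) /=.
case pj: (bit p j); rewrite ?mul0n ?subn0.
  rewrite !mul1n eqB ?leq_subr // (pzetaS h (Ordinal lt_jm)).
  by rewrite (bits_sub (b := Ordinal lt_jm)) // !inE pj eqxx mul0n addn0 mul1n addnK.
by rewrite inE pj mul0n addn0.
Qed.

Lemma ok_test :
  ok test (State w (rs 0 0 0 1 1 0) (tab (fun p => union_power g k (bits m p))))
     (State w (rs 0 0 0 1 1 (union_power g k setT %% Z))
        (tab (fun p => union_power g k (bits m p)))) X.
Proof.
have hU Y : union_power g k Y <= U.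
  rewrite -pzeta0 (leq_trans (pzeta_le _ _ _)) // pzeta_union_power.
  by rewrite pzeta_powU ?geq_minr.
set h := fun p => _; have hN : tab h (N - 1) = union_power g k setT.
  by rewrite /tab /h subn1 ltn_predL N_gt0 bits_full.
have -> : union_power g k setT %% Z = tab h (N - 1) - tab h (N - 1) %/ Z * Z.
  by rewrite hN subn_divn_mul.
apply/(ok_le leWX)/ok_assign => //; apply: boundedI.
  by rewrite /= /regular ?leUE ?eqxx ?orbT.
by apply: tab_le => p _; apply: hU.
Qed.

End Transforms.

Lemma ok_dc_cmd w (v : pred {set 'I_m}) : (forall s, nth 0 w s <= 1) ->
  (forall p, p < N -> sieved w (n * n) p = v (bits m p) * z ^ #|bits m p|) ->
  exists s', [/\ ok dc_cmd (State [:: n, l & w] (nseq 13 0) (fun=> 0)) s' X,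
    nth 0 (vars s') vx =
      union_power (fun Y => v Y * z ^ #|Y|) k setT %% Z
    & nth 0 (vars s') vx <= U].
Proof.
move=> w_le1 sievedE; set g := fun Y : {set 'I_m} => v Y * z ^ #|Y|.
have g_le Y : pzeta g m Y <= Z.
  by rewrite (leq_trans (pzeta_weight_le _ _ radix_gt0)) // expnS leq_mul2r leNz orbT.
pose h p := union_power g k (bits m p).
exists (State (drop (n * n) w) (rs 0 0 0 1 1 (union_power g k setT %% Z)) (tab h)).
split=> //; last first.
  by apply: leq_trans leZU; rewrite /= ltnW // ltn_pmod // expn_gt0 radix_gt0.
apply: ok_seq; first exact: ok_setup.
apply: ok_seq; first exact: ok_weigh.
apply: ok_seq; first exact: ok_drop_empty_classes.
apply: ok_seq; first exact: ok_drop_conflicts.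
rewrite (eq_tab sievedE); apply: ok_seq; first exact: ok_zeta g_le.
apply: ok_seq; first exact: ok_power g_le.
apply: ok_seq; first exact: ok_moebius g_le.
exact: ok_test g_le.
Qed.

End Instance.

Lemma dvdn_exp2_bits c p : (2 ^ c %| p) = [forall b : 'I_c, ~~ bit p b].
Proof.
apply/idP/forallP => [/dvdnP[q ->] b | no_bit].
  have -> : 2 ^ c = 2 * 2 ^ (c - b.+1) * 2 ^ b.
    by rewrite -expnS -expnD; congr expn; have := ltn_ord b; lia.
  by rewrite /bit mulnA mulnK ?expn_gt0 // mulnCA oddM.
elim: c no_bit => [|c IHc] no_bit; first by rewrite dvd1n.
have c_dvd : 2 ^ c %| p by apply: IHc => b; apply: (no_bit (widen_ord (leqnSn c) b)).
have := no_bit ord_max; rewrite /bit /= -dvdn2 => /dvdnP[q p_eq].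
by rewrite expnS -(divnK c_dvd) p_eq -mulnA dvdn_mull.
Qed.

Lemma prod_bool (I : finType) (P : pred I) :
  \prod_i P i = [forall i, P i] :> nat.
Proof.
have [/forallP PI | /forallPn[i /negPf Pi]] := boolP [forall i, P i].
  by rewrite big1 // => i _; rewrite PI.
by rewrite (bigD1 i) //= Pi.
Qed.

Lemma nth_allpairs S T R (f : S -> T -> R) (s : seq S) (t : seq T) x0 y0 r0 i j :
  i < size s -> j < size t ->
  nth r0 [seq f x y | x <- s, y <- t] (i * size t + j) = f (nth x0 s i) (nth y0 t j).
Proof.
elim: s i => //= x s IHs [_|i lt_i] lt_j.
  by rewrite nth_cat size_map mul0n lt_j (nth_map y0).
rewrite nth_cat size_map mulSn -addnA ltnNge leq_addr /= addKn; exact: IHs.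
Qed.

Definition adj_tape n (G : sgraph 'I_n) : seq nat :=
  [seq nat_of_bool (G i j) | i <- enum 'I_n, j <- enum 'I_n].

Lemma adj_tape_le1 n (G : sgraph 'I_n) s : nth 0 (adj_tape G) s <= 1.
Proof.
have [lt_s|le_s] := ltnP s (size (adj_tape G)); last by rewrite nth_default.
by have /allpairsP[[i j] [_ _ ->]] := mem_nth 0 lt_s; apply: leq_b1.
Qed.

Lemma nth_adj_tape n (G : sgraph 'I_n) (a b : 'I_n) :
  nth 0 (adj_tape G) (a * n + b) = G a b.
Proof.
have := @nth_allpairs _ _ _ (fun i j => nat_of_bool (G i j)) (enum 'I_n)
  (enum 'I_n) a a 0 a b.
by rewrite size_enum_ord !nth_ord_enum => ->.
Qed.

Lemma nonempty_classE n p : p < 2 ^ (n + n) ->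
  nonempty_class n p =
  (bits (n + n) p == set0) || [exists u, lshift n u \in bits (n + n) p].
Proof.
move=> lt_p; have -> : (bits (n + n) p == set0) = (p == 0).
  rewrite -[in RHS](modn_small lt_p) -[RHS]/(_ %| _) dvdn_exp2_bits.
  apply/eqP/forallP => [b0 b | no_bit].
    by have := in_set0 b; rewrite -b0 inE => ->.
  by apply/setP=> b; rewrite !inE; apply/negbTE.
have -> : [exists u, lshift n u \in bits (n + n) p] = ~~ (2 ^ n %| p).
  rewrite dvdn_exp2_bits negb_forall; apply: eq_existsb => u.
  by rewrite inE negbK.
rewrite /nonempty_class /dvdn.
case: p lt_p => [|p] _; first by rewrite mod0n.
by rewrite subSS sub0n addn0 /=; case: (_ %% _).
Qed.

Lemma sieved_adj_tape n (G : sgraph 'I_n) p : p < 2 ^ (n + n) ->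
  sieved n (adj_tape G) (n * n) p =
  dominated_class G (bits (n + n) p) * radix n ^ #|bits (n + n) p|.
Proof.
move=> lt_p; rewrite /sieved /dominated_class nonempty_classE // -mulnb.
rewrite card_bits -/(weight _ _) -mulnA mulnC; congr (_ * _); congr (_ * _).
rewrite (prod_bool (fun s : 'I_(n * n) => ~~ conflict_bits n (adj_tape G) s p)).
congr nat_of_bool.
have confE (a b : 'I_n) : conflict_bits n (adj_tape G) (a * n + b) p =
    conflict G a b (bits (n + n) p).
  rewrite /conflict_bits /conflict !inE nth_adj_tape eqb1.
  rewrite divnMDl ?modnMDl ?(leq_ltn_trans _ (ltn_ord a)) //.
  by rewrite divn_small ?modn_small // addn0.
apply/forallP/forallP => [no_conf a | no_conf s].
  apply/forallP=> b; rewrite -confE.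
  have lt_s : a * n + b < n * n.
    by have := ltn_ord a; have := ltn_ord b; nia.
  exact: (no_conf (Ordinal lt_s)).
have n_gt0 : 0 < n.
  by have := leq_ltn_trans (leq0n s) (ltn_ord s); rewrite muln_gt0 => /andP[].
have lt_a : s %/ n < n by rewrite ltn_divLR.
have lt_b : s %% n < n by rewrite ltn_mod.
have /forallP/(_ (Ordinal lt_b)) := no_conf (Ordinal lt_a).
by rewrite -confE /= -divn_eq.
Qed.

Lemma run_compiled c v s s' X m : ok c s s' X -> v < nvars -> 0 < X ->
  bitlen (nth 0 (vars s') v) <= X -> represents m s ->
  let code := compile c 0 in
  exists t sp, t <= (cmd_cost c + bitlen v + 2) * X /\
    run (code ++ [:: Jzero (Dir v) (size code).+2; Halt true; Halt false])
        (Config 0 (inp s) m) (nth 0 (vars s') v != 0) t sp.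
Proof.
move=> okc lt_v X_gt0 bv rep code; set P := _ ++ _.
have Pc : code_at P 0 code by exists [::]; eexists.
have [m' [rep' r]] := okc _ _ _ Pc rep; rewrite add0n in r.
have [P0 /code_at_cons[P1 /code_at_cons[P2 _]]] :
    onth P (size code) = Some (Jzero (Dir v) (size code).+2) /\
    code_at P (size code).+1 [:: Halt true; Halt false].
  by apply/code_at_cons; exists code, [::]; rewrite cats0.
have /= r1 := reach_step (inp s') m' P0 isT; rewrite rep'.1 // in r1.
set x := nth 0 (vars s') v in bv r1 *.
have halts : exists sp, run P
    (Config (if x == 0 then (size code).+2 else (size code).+1) (inp s') m')
    (x != 0) 1 sp.
  by case: eqP => _; eexists; apply: run_halt; rewrite /= ?P1 ?P2.
have [sp /(reach_trans r r1)[t [sp' [le_t rt]]]] := halts.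
exists t, sp'; split=> //; apply: leq_trans le_t _.
by rewrite !mulnDl; have := leq_pmulr (bitlen v) X_gt0; lia.
Qed.

Lemma time_unit_le (x : dc_instance) :
  time_unit (dc_order x) (dc_budget x) <= 48 * dc_size x ^ 5 * 4 ^ dc_order x.
Proof.
rewrite /time_unit /word_size /value_bound /radix /dc_size.
set n := dc_order x; set l := dc_budget x.
have N4 : 2 ^ (n + n) = 4 ^ n by rewrite expnD -expnMn.
have -> : ((2 * (2 ^ (n + n)) ^ n) ^ (n + n).+1) ^ n.+1 =
    2 ^ ((1 + (n + n) * n) * (n + n).+1 * n.+1).
  by rewrite add1n -[_ ^ n]expnM -expnS -!expnM mulnA.
rewrite [bitlen (2 ^ _)]/bitlen trunc_expnK //.
rewrite N4; have : 0 < 4 ^ n by rewrite expn_gt0.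
move: (4 ^ n) => N N_gt0; set S := _ + n ^ 2.
have nS : n.+1 <= S by rewrite /S /bitlen; nia.
have nnS : n * n + 1 <= S by rewrite /S /bitlen -mulnn; lia.
have lS : bitlen l <= S by rewrite /S; lia.
have W_le : bitlen l + ((1 + (n + n) * n) * (n + n).+1 * n.+1).+1 <= 6 * S ^ 3.
  have le1 : (1 + (n + n) * n) * (n + n).+1 * n.+1 <= (2 * S) * (2 * S) * S.
    by rewrite !leq_mul //; lia.
  have leS3 : S <= S ^ 3 by rewrite -{1}[S]expn1 leq_pexp2l //; lia.
  have -> : 6 * S ^ 3 = S ^ 3 + S ^ 3 + (2 * S) * (2 * S) * S by rewrite !expnS; nia.
  by lia.
have -> : 48 * S ^ 5 * N = (2 * S) * ((2 * S) * ((2 * N) * (6 * S ^ 3))).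
  by rewrite !expnS; nia.
by rewrite !leq_mul //; lia.
Qed.

Theorem theorem2 :
  exists (P : program) (time space : dc_instance -> nat),
    [/\ solves_dominator_coloring P time space,
        Ostar time (fun x => 4 ^ dc_order x)
      & exists a : nat, Ostar space (fun x => a ^ dc_order x)].
Proof.
pose K := cmd_cost dc_cmd + bitlen vx + 2.
have main (x : dc_instance) : exists ts : nat * nat,
    (exists b : bool, run dc_program (initial_config (dc_input x)) b ts.1 ts.2 /\
       (b <-> has_dominator_coloring (dc_graph x) (dc_budget x))) /\
    ts.1 <= K * 48 * dc_size x ^ 5 * 4 ^ dc_order x.
  case: x => n G l /=; set w := adj_tape G.
  have [s' [ok_s' xE xU]] := ok_dc_cmd l (adj_tape_le1 G) (@sieved_adj_tape n G).
  have X_gt0 : 0 < time_unit n l by rewrite !muln_gt0 /word_size addn_gt0.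
  have bx : bitlen (nth 0 (vars s') vx) <= time_unit n l.
    exact: leq_trans (bitlen_leU l xU) (leWX n l).
  have rep : represents [fsfun] (State [:: n, l & w] (nseq 13 0) (fun=> 0)).
    split=> [i _|p]; rewrite fsfun0E //.
    by rewrite -[vars _]/(nseq 13 0) nth_nseq if_same.
  have [t [sp [le_t run_t]]] := run_compiled ok_s' (isT : vx < nvars) X_gt0 bx rep.
  exists (t, sp); split=> /=; last first.
    have le_X := time_unit_le (DCInstance G l).
    by apply: leq_trans le_t _; rewrite -2!(mulnA K) leq_mul2l le_X orbT.
  eexists; split; first exact: run_t.
  rewrite xE -dominator_coloringP.
  have z_big : (2 ^ (n + n)) ^ minn l n < radix n.
    rewrite /radix mul2n -addnn -[X in X < _]addn0 -addnS leq_add ?expn_gt0 //.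
    by rewrite leq_pexp2l ?geq_minr ?expn_gt0.
  by split=> h; apply/(union_power_mod (dominated_class G) z_big).
have [ts tsP] := choice _ main.
exists dc_program, (fun x => (ts x).1), (fun x => (ts x).2); split.
- by move=> x; have [] := tsP x.
- by exists (K * 48), 5 => x; have [] := tsP x.
exists 4, (K * 48), 5 => x; have [[b [/run_space le_s _]] le_t] := tsP x.
apply: leq_trans le_t; apply: leq_trans le_s _.
by rewrite /mem_space finsupp0 big_seq_fset0.
Qed.
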